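(* Let $(Q,I)$ be a complete gentle quiver, $k$ a field, $\Lambda$ the arrow ideal completion of $kQ/I$, let $m$ be a map from the set of $\sigma$-orbits of $Q_1$ to the positive integers, and let $A=\Lambda/z\Lambda$ with $z=\sum_{a\in Q_1}c_a^{m(v_a)}$ be the associated twisted Brauer graph algebra. Then the functor $\nu_A$ is induced by some involution $\overline{\varepsilon}$ of the algebra $A$, that is, there are an involution $\overline{\varepsilon}$ of $A$ and an isomorphism of functors $\nu_A\cong(-)_{\overline{\varepsilon}}$. Consequently there are isomorphisms of functors $\mathbb{S}_A\cong(-)_{\overline{\varepsilon}}$ and $\mathbb{S}_A^2\cong\mathrm{Id}$.
   Context: $k$ is a field. All modules are finitely generated left modules. Paths are composed from right to left; products of non-composable arrows are zero. A finite quiver with relations $(Q,I)$ is complete gentle if (1) there are exactly two arrows starting and exactly two arrows ending at each vertex; (2) for any arrow $b\in Q_1$ there are unique arrows $a,c\in Q_1$ such that $cb\notin I$ and $ba\notin I$; (3) the ideal $I$ is generated by paths of length two. For $a\in Q_1$ let $\sigma(a)$ be the unique arrow with $\sigma(a)a\notin I$; this defines a permutation $\sigma$ of $Q_1$. Let $v_a$ be the $\sigma$-orbit of $a$, $n(a)$ its length and $c_a=\sigma^{n(a)-1}(a)\cdots\sigma(a)a$ the repetition-free cyclic path starting with $a$. The element $z$ is central in $\Lambda$, and $A$ is a finite-dimensional $k$-algebra. An involution of $A$ is a $k$-algebra automorphism whose square is the identity. For an involution $\overline{\varepsilon}$, $A_{\overline{\varepsilon}}$ is the $A$-bimodule $A$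 with regular left structure and right structure $a\star b=a\,\overline{\varepsilon}(b)$, and $(-)_{\overline{\varepsilon}}=A_{\overline{\varepsilon}}\otimes_A-$. The derived Nakayama functor is $\nu_A=A^*\otimes^{\mathbb{L}}_A-$ on $D^-(\mathrm{mod}\,A)$, where $A^*=\mathrm{Hom}_k(A,k)$; the Serre functor is $\mathbb{S}_A=\nu_A$, on the category $\mathrm{Perf}(A)$ of perfect complexes. *)

(* Defs.v *)
From HB Require Import structures.
From mathcomp Require Import all_boot all_order all_algebra perm.
From mathcomp Require Import finmap boolp.
From mathcomp Require Import xfinmap monalg.
Set Implicit Arguments. Unset Strict Implicit. Unset Printing Implicit Defensive.
Import Order.TTheory GRing.Theory Num.Theory.
Local Open Scope ring_scope.
Local Open Scope quotient_scope.

(* A k-algebra is a ring with a central ring morphism from k.  The ring may be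
   zero (pzRingType), so that quotients and the empty quiver are covered. *)
Record kalgebra (k : fieldType) := KAlgebra {
  alg_ring :> pzRingType;
  alg_map : {rmorphism k -> alg_ring};
  alg_central : forall c x, alg_map c * x = x * alg_map c }.

(* Two-sided ideals; J is closed under opposites since - x = (- 1) * x. *)
Definition ideal (R : pzRingType) (J : R -> Prop) : Prop :=
  [/\ J 0, forall x y, J x -> J y -> J (x + y),
      forall a x, J x -> J (a * x) & forall a x, J x -> J (x * a)].

Definition ideal_gen (R : pzRingType) (S : R -> Prop) (x : R) : Prop :=
  forall J, ideal J -> (forall y, S y -> J y) -> J x.

Fixpoint ideal_pow (R : pzRingType) (J : R -> Prop) (n : nat) : R -> Prop :=
  if n is n'.+1
  then ideal_gen (fun x => exists a b, [/\ J a, ideal_pow J n' b & x = a * b])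
  else fun=> True.

Lemma ideal_gen_ideal (R : pzRingType) (S : R -> Prop) : ideal (ideal_gen S).
Proof.
split=> [J [J0 _ _ _] //|x y hx hy J hJ hS|a x hx J hJ hS|a x hx J hJ hS];
  have [J0 JD Jl Jr] := hJ.
- exact: JD (hx J hJ hS) (hy J hJ hS).
- exact: Jl (hx J hJ hS).
- exact: Jr (hx J hJ hS).
Qed.

Lemma ideal_genS (R : pzRingType) (S : R -> Prop) x : S x -> ideal_gen S x.
Proof. by move=> Sx J _; apply. Qed.

Lemma idealN (R : pzRingType) (J : R -> Prop) x : ideal J -> J x -> J (- x).
Proof. by case=> _ _ Jl _ Jx; rewrite -mulN1r; apply: Jl. Qed.

(* The quotient of R by the two-sided ideal generated by S. *)
Section Quotient.
Variables (R : pzRingType) (S : R -> Prop).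
Implicit Types x y : R.

Definition quot_rel x y : bool := `[< ideal_gen S (x - y) >].

Lemma quot_rel_refl : reflexive quot_rel.
Proof. by move=> x; apply/asboolP; rewrite subrr; case: (ideal_gen_ideal S). Qed.

Lemma quot_rel_sym : symmetric quot_rel.
Proof.
suff h x y : quot_rel x y -> quot_rel y x by move=> x y; apply/idP/idP; apply: h.
move=> /asboolP/(idealN (ideal_gen_ideal S)) h.
by apply/asboolP; rewrite -opprB.
Qed.

Lemma quot_rel_trans : transitive quot_rel.
Proof.
move=> y x z /asboolP h1 /asboolP h2; apply/asboolP; rewrite -(subrKA y).
by have [_ hD _ _] := ideal_gen_ideal S; apply: hD.
Qed.

Canonical quot_equiv :=
  EquivRel quot_rel quot_rel_refl quot_rel_sym quot_rel_trans.

Definition quot_ring := {eq_quot quot_equiv}.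
HB.instance Definition _ := EqQuotient.on quot_ring.
HB.instance Definition _ := Choice.on quot_ring.

Definition quot_pi (x : R) : quot_ring := \pi x.

Lemma quot_piE x y : (quot_pi x = quot_pi y) <-> ideal_gen S (x - y).
Proof.
split=> [/eqP|h]; first by rewrite eqmodE => /asboolP.
by apply/eqP; rewrite eqmodE; apply/asboolP.
Qed.

Lemma quot_piK (u : quot_ring) : quot_pi (repr u) = u.
Proof. exact: reprK. Qed.

Lemma quot_pi_surj (u : quot_ring) : exists x, u = quot_pi x.
Proof. by exists (repr u); rewrite quot_piK. Qed.

Let add (u v : quot_ring) : quot_ring := quot_pi (repr u + repr v).
Let opp (u : quot_ring) : quot_ring := quot_pi (- repr u).
Let mul (u v : quot_ring) : quot_ring := quot_pi (repr u * repr v).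

Let addE x y : add (quot_pi x) (quot_pi y) = quot_pi (x + y).
Proof.
apply/quot_piE; rewrite opprD addrACA.
have [_ hD _ _] := ideal_gen_ideal S.
by apply: hD; apply/quot_piE; rewrite quot_piK.
Qed.

Let oppE x : opp (quot_pi x) = quot_pi (- x).
Proof.
apply/quot_piE; rewrite -opprD; apply: (idealN (ideal_gen_ideal S)).
by apply/quot_piE; rewrite quot_piK.
Qed.

Let mulE x y : mul (quot_pi x) (quot_pi y) = quot_pi (x * y).
Proof.
have [_ hD hl hr] := ideal_gen_ideal S.
set x' := repr (quot_pi x); set y' := repr (quot_pi y).
have hx : ideal_gen S (x' - x) by apply/quot_piE; rewrite quot_piK.
have hy : ideal_gen S (y' - y) by apply/quot_piE; rewrite quot_piK.
apply/quot_piE; rewrite -(subrKA (x' * y)) -mulrBr -mulrBl.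
by apply: hD; [apply: hl|apply: hr].
Qed.

Let addA : associative add.
Proof.
move=> u v w; have [[[x ->] [y ->]] [z ->]] := (quot_pi_surj u, quot_pi_surj v, quot_pi_surj w).
by rewrite !addE addrA.
Qed.
Let addC : commutative add.
Proof.
move=> u v; have [[x ->] [y ->]] := (quot_pi_surj u, quot_pi_surj v).
by rewrite !addE addrC.
Qed.
Let add0 : left_id (quot_pi 0) add.
Proof. by move=> u; have [x ->] := quot_pi_surj u; rewrite !addE add0r. Qed.
Let addN : left_inverse (quot_pi 0) opp add.
Proof. by move=> u; have [x ->] := quot_pi_surj u; rewrite !oppE addE addNr. Qed.

HB.instance Definition _ := GRing.isZmodule.Build quot_ring addA addC add0 addN.

Let addqE x y : quot_pi x + quot_pi y = quot_pi (x + y).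
Proof. exact: addE. Qed.

Let mulA : associative mul.
Proof.
move=> u v w; have [[[x ->] [y ->]] [z ->]] := (quot_pi_surj u, quot_pi_surj v, quot_pi_surj w).
by rewrite !mulE mulrA.
Qed.
Let mul1 : left_id (quot_pi 1) mul.
Proof. by move=> u; have [x ->] := quot_pi_surj u; rewrite !mulE mul1r. Qed.
Let mulr1 : right_id (quot_pi 1) mul.
Proof. by move=> u; have [x ->] := quot_pi_surj u; rewrite !mulE mulr1. Qed.
Let mulDl : left_distributive mul +%R.
Proof.
move=> u v w; have [[[x ->] [y ->]] [z ->]] := (quot_pi_surj u, quot_pi_surj v, quot_pi_surj w).
by rewrite !(addqE, mulE) mulrDl.
Qed.
Let mulDr : right_distributive mul +%R.
Proof.
move=> u v w; have [[[x ->] [y ->]] [z ->]] := (quot_pi_surj u, quot_pi_surj v, quot_pi_surj w).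
by rewrite !(addqE, mulE) mulrDr.
Qed.

HB.instance Definition _ :=
  GRing.Zmodule_isPzRing.Build quot_ring mulA mul1 mulr1 mulDl mulDr.

Let quot_piB : zmod_morphism quot_pi.
Proof. by move=> x y; rewrite -addE -oppE. Qed.
Let quot_piM : monoid_morphism quot_pi.
Proof. by split=> // x y; rewrite -mulE. Qed.
HB.instance Definition _ :=
  GRing.isZmodMorphism.Build R quot_ring quot_pi quot_piB.
HB.instance Definition _ :=
  GRing.isMonoidMorphism.Build R quot_ring quot_pi quot_piM.
End Quotient.

Section QuotientAlgebra.
Variables (k : fieldType) (R : kalgebra k) (S : R -> Prop).

Lemma quot_central c (u : quot_ring S) :
  quot_pi S (alg_map R c) * u = u * quot_pi S (alg_map R c).
Proof.
by have [x ->] := quot_pi_surj u; rewrite -!rmorphM alg_central.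
Qed.

Definition quot : kalgebra k :=
  @KAlgebra k (quot_ring S) (quot_pi S \o alg_map R) quot_central.
End QuotientAlgebra.

(* The inverse limit of the rings R / J^n: two consecutive components are
   compatible when they are the classes of a common element of R. *)
Section Completion.
Variables (R : pzRingType) (J : R -> Prop).

Record completion_ring := Completion {
  level : forall n, quot_ring (ideal_pow J n);
  level_compat : forall n, exists r,
    level n.+1 = quot_pi _ r /\ level n = quot_pi _ r }.

HB.instance Definition _ := gen_eqMixin completion_ring.
HB.instance Definition _ := gen_choiceMixin completion_ring.

Lemma completion_eq x y : (forall n, level x n = level y n) -> x = y.
Proof.
case: x y => [x hx] [y hy] /= h.
have e : x = y by apply: functional_extensionality_dep.
by subst y; congr Completion; apply: Prop_irrelevance.
Qed.

Definition completion_map (r : R) : completion_ring :=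
  @Completion (fun n => quot_pi _ r) (fun n => ex_intro _ r (conj erefl erefl)).

Lemma cadd_compat (x y : completion_ring) n : exists r,
  level x n.+1 + level y n.+1 = quot_pi _ r /\ level x n + level y n = quot_pi _ r.
Proof.
have [[r [-> ->]] [s [-> ->]]] := (level_compat x n, level_compat y n).
by exists (r + s); rewrite !rmorphD.
Qed.
Lemma copp_compat (x : completion_ring) n : exists r,
  - level x n.+1 = quot_pi _ r /\ - level x n = quot_pi _ r.
Proof.
by have [r [-> ->]] := level_compat x n; exists (- r); rewrite !rmorphN.
Qed.
Lemma cmul_compat (x y : completion_ring) n : exists r,
  level x n.+1 * level y n.+1 = quot_pi _ r /\ level x n * level y n = quot_pi _ r.
Proof.
have [[r [-> ->]] [s [-> ->]]] := (level_compat x n, level_compat y n).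
by exists (r * s); rewrite !rmorphM.
Qed.

Let add x y := Completion (cadd_compat x y).
Let opp x := Completion (copp_compat x).
Let mul x y := Completion (cmul_compat x y).
Let zero := completion_map 0.
Let one := completion_map 1.

Let addA : associative add.
Proof. by move=> x y z; apply: completion_eq => n /=; rewrite addrA. Qed.
Let addC : commutative add.
Proof. by move=> x y; apply: completion_eq => n /=; rewrite addrC. Qed.
Let add0 : left_id zero add.
Proof. by move=> x; apply: completion_eq => n /=; rewrite rmorph0 add0r. Qed.
Let addN : left_inverse zero opp add.
Proof. by move=> x; apply: completion_eq => n /=; rewrite rmorph0 addNr. Qed.
HB.instance Definition _ := GRing.isZmodule.Build completion_ring addA addC add0 addN.

Let mulA : associative mul.
Proof. by move=> x y z; apply: completion_eq => n /=; rewrite mulrA. Qed.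
Let mul1 : left_id one mul.
Proof. by move=> x; apply: completion_eq => n /=; rewrite rmorph1 mul1r. Qed.
Let mulr1 : right_id one mul.
Proof. by move=> x; apply: completion_eq => n /=; rewrite rmorph1 mulr1. Qed.
Let mulDl : left_distributive mul +%R.
Proof. by move=> x y z; apply: completion_eq => n /=; rewrite mulrDl. Qed.
Let mulDr : right_distributive mul +%R.
Proof. by move=> x y z; apply: completion_eq => n /=; rewrite mulrDr. Qed.
HB.instance Definition _ :=
  GRing.Zmodule_isPzRing.Build completion_ring mulA mul1 mulr1 mulDl mulDr.

Let completion_mapB : zmod_morphism completion_map.
Proof. by move=> x y; apply: completion_eq => n /=; rewrite rmorphB. Qed.
Let completion_mapM : monoid_morphism completion_map.
Proof. by split=> // x y; apply: completion_eq => n /=; rewrite rmorphM. Qed.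
HB.instance Definition _ :=
  GRing.isZmodMorphism.Build R completion_ring completion_map completion_mapB.
HB.instance Definition _ :=
  GRing.isMonoidMorphism.Build R completion_ring completion_map completion_mapM.
End Completion.

Section CompletionAlgebra.
Variables (k : fieldType) (R : kalgebra k) (J : R -> Prop).
Lemma completion_central c (x : completion_ring J) :
  completion_map J (alg_map R c) * x = x * completion_map J (alg_map R c).
Proof.
apply: completion_eq => n.
exact: (@quot_central k R (ideal_pow J n) c (level x n)).
Qed.
Definition completion : kalgebra k :=
  @KAlgebra k (completion_ring J) (completion_map J \o alg_map R) completion_central.
End CompletionAlgebra.

Record quiver := Quiver {
  vertex : finType; arrow : finType;
  src : arrow -> vertex; tgt : arrow -> vertex }.

(* A path is a pair (i, w), where i is its starting vertex and w the list of its
   arrows in the order in which they are traversed; (i, [::]) is the trivial path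
   at i.  As paths are composed from right to left, path_comp p q is "q, then p":
   the product c * b of arrows is the path b followed by c if tgt b = src c, and
   0 otherwise. *)
Section PathAlgebra.
Variables (k : fieldType) (Q : quiver).

Fixpoint walk (i : vertex Q) (w : seq (arrow Q)) : bool :=
  if w is a :: w' then (src a == i) && walk (tgt a) w' else true.

Definition qpath := {p : vertex Q * seq (arrow Q) | walk p.1 p.2}.
HB.instance Definition _ := Choice.on qpath.

Definition path_start (p : qpath) : vertex Q := (val p).1.
Definition path_end (p : qpath) : vertex Q :=
  last (val p).1 [seq tgt a | a <- (val p).2].

Lemma walk_cat i (v w : seq (arrow Q)) :
  walk i (v ++ w) = walk i v && walk (last i [seq tgt a | a <- v]) w.
Proof. by elim: v i => //= a v IH i; rewrite IH andbA. Qed.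

Lemma walk_comp (p q : qpath) : path_start p = path_end q ->
  walk (val q).1 ((val q).2 ++ (val p).2).
Proof. by move=> e; rewrite walk_cat (valP q) -/(path_end q) -e (valP p). Qed.

Lemma walk_arrow (a : arrow Q) : walk (src a) [:: a].
Proof. by rewrite /= eqxx. Qed.

Definition path_vertex (i : vertex Q) : qpath := Sub (i, [::]) isT.
Definition path_arrow (a : arrow Q) : qpath := Sub (src a, [:: a]) (walk_arrow a).

Definition path_comp (p q : qpath) : option qpath :=
  if path_start p =P path_end q is ReflectT e
  then Some (Sub ((val q).1, (val q).2 ++ (val p).2) (walk_comp e)) else None.

Definition path_ring := {malg k[qpath]}.
HB.instance Definition _ := GRing.Lmodule.on path_ring.

Definition of_path (p : qpath) : path_ring := << p >>.
Definition of_opath (o : option qpath) : path_ring :=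
  if o is Some p then of_path p else 0.

Definition path_mul (f g : path_ring) : path_ring :=
  \sum_(p <- msupp f) \sum_(q <- msupp g) (f@_p * g@_q) *: of_opath (path_comp p q).

Definition path_one : path_ring := \sum_(i : vertex Q) of_path (path_vertex i).

Let lext (h : qpath -> path_ring) (f : path_ring) : path_ring :=
  \sum_(p <- msupp f) f@_p *: h p.

Let lextw (d : {fset qpath}) h f : (msupp f `<=` d)%fset ->
  lext h f = \sum_(p <- d) f@_p *: h p.
Proof.
move=> le; rewrite /lext (big_fset_incl _ le) //= => p _ /mcoeff_outdom ->.
by rewrite scale0r.
Qed.

Let lextP h : linear (lext h).
Proof.
move=> c f g; set d := (msupp f `|` msupp g)%fset.
rewrite (@lextw d h f) ?fsubsetUl // (@lextw d h g) ?fsubsetUr //.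
rewrite (@lextw d h (c *: f + g)); last first.
  apply: fsubset_trans (msuppD_le _ _) _.
  by apply: fsetSU; apply: msuppZ_le.
rewrite scaler_sumr -big_split /=; apply: eq_bigr => p _.
by rewrite mcoeffD mcoeffZ scalerDl scalerA.
Qed.
HB.instance Definition _ h :=
  GRing.isLinear.Build k path_ring path_ring _ (lext h) (lextP h).

Let lextU h p : lext h (of_path p) = h p.
Proof.
rewrite (@lextw [fset p]%fset) ?big_seq_fset1 /= ?mcoeffUU ?scale1r //.
exact: msuppU_le.
Qed.

Let path_ringE (f : path_ring) : f = lext of_path f.
Proof.
rewrite [LHS]monalgE; apply: eq_bigr => p _; apply/malgP => q.
by rewrite mcoeffZ !mcoeffU mulr_natr.
Qed.

Let path_mulE f g :
  path_mul f g = lext (fun p => lext (fun q => of_opath (path_comp p q)) g) f.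
Proof.
apply: eq_bigr => p _; rewrite [in RHS]/lext scaler_sumr.
by apply: eq_bigr => q _; rewrite scalerA.
Qed.

Let path_mulr (g : path_ring) : linear (path_mul^~ g).
Proof. by move=> c x y; rewrite !path_mulE linearP. Qed.

Let path_mull (f : path_ring) : linear (path_mul f).
Proof.
move=> c x y; rewrite !path_mulE /lext scaler_sumr -big_split.
apply: eq_bigr => p _ /=.
by rewrite -[\sum_(_ <- msupp (c *: x + y)) _]/(lext _ _) linearP scalerDr !scalerA mulrC.
Qed.

Lemma of_pathM p q : path_mul (of_path p) (of_path q) = of_opath (path_comp p q).
Proof. by rewrite path_mulE !lextU. Qed.

Lemma path_ring_ind (P : path_ring -> Prop) :
  P 0 -> (forall p, P (of_path p)) -> (forall c x y, P x -> P y -> P (c *: x + y)) ->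
  forall x, P x.
Proof.
move=> P0 PU PD x; rewrite [x]path_ringE /lext.
by apply: big_rec => // p y _ Py; apply: PD.
Qed.

Let path_mul0r f : path_mul 0 f = 0.
Proof. by rewrite path_mulE linear0. Qed.
Let path_mulr0 f : path_mul f 0 = 0.
Proof.
by rewrite path_mulE /lext big1 // => p _; rewrite msupp0 big_seq_fset0 scaler0.
Qed.

Let path_compE (p q : qpath) (e : path_start p = path_end q) :
  path_comp p q = Some (Sub ((val q).1, (val q).2 ++ (val p).2) (walk_comp e)).
Proof.
rewrite /path_comp; case: eqP => // e'; congr Some; exact: val_inj.
Qed.

Let path_compN (p q : qpath) : path_start p <> path_end q -> path_comp p q = None.
Proof. by rewrite /path_comp; case: eqP. Qed.

Lemma path_comp_spec (p q : qpath) :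
  (path_start p <> path_end q /\ path_comp p q = None) \/
  (path_start p = path_end q /\ exists r, [/\ path_comp p q = Some r,
     path_start r = path_start q, path_end r = path_end p &
     val r = ((val q).1, (val q).2 ++ (val p).2)]).
Proof.
case: (path_start p =P path_end q) => e; last by left; rewrite path_compN.
right; split=> //; rewrite (path_compE e); eexists; split; first by [].
- by rewrite /path_start SubK.
- by rewrite /path_end SubK /= map_cat last_cat -/(path_end q) -e.
- by rewrite SubK.
Qed.

Let mul_ou (o : option qpath) p :
  path_mul (of_opath o) (of_path p) = of_opath (obind (path_comp^~ p) o).
Proof. by case: o => [q|] /=; rewrite ?of_pathM ?path_mul0r. Qed.
Let mul_uo (o : option qpath) p :
  path_mul (of_path p) (of_opath o) = of_opath (obind (path_comp p) o).
Proof. by case: o => [q|] /=; rewrite ?of_pathM ?path_mulr0. Qed.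

Let path_compA p q r :
  obind (path_comp p) (path_comp q r) = obind (path_comp^~ r) (path_comp p q).
Proof.
case: (path_comp_spec q r) => [[n1 e1]|[n1 [u [e1 su eu vu]]]]; rewrite e1 /=.
  case: (path_comp_spec p q) => [[n2 e2]|[n2 [v [e2 sv ev vv]]]]; rewrite e2 //=.
  by rewrite path_compN // sv.
case: (path_comp_spec p q) => [[n2 e2]|[n2 [v [e2 sv ev vv]]]]; rewrite e2 /=.
  by rewrite path_compN // eu.
case: (path_comp_spec p u) => [[]|[_ [x [-> _ _ vx]]]]; first by rewrite eu.
case: (path_comp_spec v r) => [[]|[_ [y [-> _ _ vy]]]]; first by rewrite sv.
by congr Some; apply: val_inj; rewrite vx vy vu vv /= catA.
Qed.

Let path_mulA : associative (path_mul).
Proof.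
move=> f g h; elim/path_ring_ind: f => [|p|c x y IHx IHy].
- by rewrite !path_mul0r.
- elim/path_ring_ind: g => [|q|c x y IHx IHy].
  + by rewrite path_mulr0 !path_mul0r path_mulr0.
  + elim/path_ring_ind: h => [|r|c x y IHx IHy].
    * by rewrite !path_mulr0.
    * by rewrite !of_pathM mul_ou mul_uo path_compA.
    * by rewrite !path_mull IHx IHy.
  + by rewrite path_mulr !path_mull path_mulr IHx IHy.
- by rewrite !path_mulr IHx IHy.
Qed.

Let path_mulDl : left_distributive path_mul +%R.
Proof. by move=> x y z; rewrite -[x]scale1r path_mulr !scale1r. Qed.
Let path_mulDr : right_distributive path_mul +%R.
Proof. by move=> x y z; rewrite -[y]scale1r path_mull !scale1r. Qed.

Let comp_vertexl i p :
  path_comp (path_vertex i) p = if i == path_end p then Some p else None.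
Proof.
case: eqP => e; last by rewrite path_compN.
rewrite path_compE; congr Some; apply: val_inj.
by rewrite SubK /= cats0; case: (val p).
Qed.
Let comp_vertexr i p :
  path_comp p (path_vertex i) = if i == path_start p then Some p else None.
Proof.
case: eqP => [->|e]; last by rewrite path_compN // => e'; apply: e.
rewrite path_compE; congr Some; apply: val_inj.
by rewrite SubK /=; case: p => -[].
Qed.

Let path_sumr (F : vertex Q -> path_ring) f :
  path_mul (\sum_i F i) f = \sum_i path_mul (F i) f.
Proof.
by apply: (big_morph (path_mul^~ f)) => [x y|]; [apply: path_mulDl | apply: path_mul0r].
Qed.
Let path_suml (F : vertex Q -> path_ring) f :
  path_mul f (\sum_i F i) = \sum_i path_mul f (F i).
Proof.
by apply: (big_morph (path_mul f)) => [x y|]; [apply: path_mulDr | apply: path_mulr0].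
Qed.

Let path_mul1 : left_id path_one path_mul.
Proof.
move=> f; elim/path_ring_ind: f => [|p|c x y IHx IHy]; first exact: path_mulr0.
  rewrite path_sumr (bigD1 (path_end p)) //= of_pathM comp_vertexl eqxx /=.
  rewrite big1 ?addr0 // => i /negPf ne.
  by rewrite of_pathM comp_vertexl ne.
by rewrite path_mull IHx IHy.
Qed.
Let path_mulr1 : right_id path_one path_mul.
Proof.
move=> f; elim/path_ring_ind: f => [|p|c x y IHx IHy]; first exact: path_mul0r.
  rewrite path_suml (bigD1 (path_start p)) //= of_pathM comp_vertexr eqxx /=.
  rewrite big1 ?addr0 // => i /negPf ne.
  by rewrite of_pathM comp_vertexr ne.
by rewrite path_mulr IHx IHy.
Qed.

HB.instance Definition _ := GRing.Zmodule_isPzRing.Build path_ring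
  path_mulA path_mul1 path_mulr1 path_mulDl path_mulDr.

Lemma path_scalerAl (c : k) (f g : path_ring) : c *: (f * g) = (c *: f) * g.
Proof.
have := path_mulr g c f 0; rewrite addr0 path_mul0r addr0 => <-; exact: erefl.
Qed.
Lemma path_scalerAr (c : k) (f g : path_ring) : c *: (f * g) = f * (c *: g).
Proof.
have := path_mull f c g 0; rewrite addr0 path_mulr0 addr0 => <-; exact: erefl.
Qed.

Definition path_const (c : k) : path_ring := c *: (1 : path_ring).

Let path_constB : zmod_morphism path_const.
Proof. by move=> c d; rewrite /path_const scalerBl. Qed.
Let path_constM : monoid_morphism path_const.
Proof.
split=> [|c d]; first exact: scale1r.
by rewrite /path_const -path_scalerAl mul1r scalerA.
Qed.
HB.instance Definition _ :=
  GRing.isZmodMorphism.Build k path_ring path_const path_constB.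
HB.instance Definition _ :=
  GRing.isMonoidMorphism.Build k path_ring path_const path_constM.

Lemma path_central c (x : path_ring) : path_const c * x = x * path_const c.
Proof. by rewrite /path_const -path_scalerAl -path_scalerAr mul1r mulr1. Qed.

Definition path_algebra : kalgebra k := @KAlgebra k path_ring path_const path_central.

Definition arrow_elt (a : arrow Q) : path_algebra := of_path (path_arrow a).
End PathAlgebra.

Definition path_length (Q : quiver) (p : qpath Q) : nat :=
  size (val p).2.

(* Products of non-composable arrows are 0, hence lie in I, so that the arrows in
   the second condition are automatically composable with b. *)
Definition complete_gentle (k : fieldType) (Q : quiver)
    (I : path_algebra k Q -> Prop) : Prop :=
  [/\ forall i : vertex Q,
        #|[set a | src a == i]| = 2%N /\ #|[set a | tgt a == i]| = 2%N,
      forall b : arrow Q,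
        (exists! c, ~ I (arrow_elt k c * arrow_elt k b)) /\
        (exists! a, ~ I (arrow_elt k b * arrow_elt k a)) &
      exists S : qpath Q -> Prop, (forall p, S p -> path_length p = 2%N) /\
        forall x, I x <-> ideal_gen (fun y => exists2 p, S p & y = of_path k p) x].

Record gentle_quiver (k : fieldType) := GentleQuiver {
  gentle_q :> quiver;
  gentle_ideal : path_algebra k gentle_q -> Prop;
  gentleP : complete_gentle gentle_ideal }.

Section GentleAlgebra.
Variables (k : fieldType) (Q : gentle_quiver k).
Local Notation I := (@gentle_ideal k Q).

Lemma sigma_ex (b : arrow Q) :
  exists c, unique (fun c => ~ I (arrow_elt k c * arrow_elt k b)) c.
Proof. by case: (gentleP Q) => _ h _; exact: (h b).1. Qed.

Definition sigma_fun (b : arrow Q) : arrow Q := projT1 (cid (sigma_ex b)).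

Lemma sigma_funP (b c : arrow Q) :
  ~ I (arrow_elt k c * arrow_elt k b) <-> c = sigma_fun b.
Proof.
rewrite /sigma_fun; case: (cid _) => d [hd ud] /=.
split=> [/ud ->|->] //.
Qed.

Lemma sigma_inj : injective sigma_fun.
Proof.
move=> a b e; case: (gentleP Q) => _ h _.
have [d [_ ud]] := (h (sigma_fun a)).2.
have ha := proj2 (sigma_funP a _) erefl.
have hb := proj2 (sigma_funP b _) e.
exact: etrans (esym (ud _ ha)) (ud _ hb).
Qed.

Definition sigma : {perm arrow Q} := perm sigma_inj.

Definition arrow_ideal : quot I -> Prop :=
  ideal_gen (fun x => exists a, x = quot_pi I (arrow_elt k a)).

Definition gentle_algebra : kalgebra k := completion arrow_ideal.

Definition gentle_arrow (a : arrow Q) : gentle_algebra :=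
  completion_map arrow_ideal (quot_pi I (arrow_elt k a)).

(* The product sigma^(n - 1) a * ... * sigma a * a, with n the length of the
   sigma-orbit of a. *)
Definition cyclic_path (a : arrow Q) : gentle_algebra :=
  \prod_(b <- rev (traject sigma a #|porbit sigma a|)) gentle_arrow b.

Definition central_elt (m : {set arrow Q} -> nat) : gentle_algebra :=
  \sum_(a : arrow Q) cyclic_path a ^+ m (porbit sigma a).

(* Only the values of m on the sigma-orbits (the elements of porbits sigma) are
   used.  As central_elt m is central, the set of its multiples is already the
   ideal it generates. *)
Definition twisted_brauer_graph_algebra (m : {set arrow Q} -> nat) : kalgebra k :=
  quot (fun x : gentle_algebra => exists y, x = central_elt m * y).
End GentleAlgebra.

Definition finite_dimensional (k : fieldType) (A : kalgebra k) : Prop :=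
  exists n (g : 'I_n -> A), forall x, exists c : 'I_n -> k,
    x = \sum_(i < n) alg_map A (c i) * g i.

(* Finite-dimensionality of the twisted Brauer graph algebra: long paths in
   kQ / I are multiples of z. *)
Lemma alg_mulACA (k : fieldType) (A : kalgebra k) c d (x y : A) :
  alg_map A c * x * (alg_map A d * y) = alg_map A (c * d) * (x * y).
Proof.
rewrite rmorphM -!mulrA; congr (_ * _); rewrite !mulrA; congr (_ * _).
by rewrite alg_central.
Qed.

Lemma alg_sum_lin (k : fieldType) (A : kalgebra k) (T : finType) c (d d' : T -> k)
    (v : T -> A) y y' :
  alg_map A c * (\sum_i alg_map A (d i) * v i + y) +
    (\sum_i alg_map A (d' i) * v i + y') =
  \sum_i alg_map A (c * d i + d' i) * v i + (alg_map A c * y + y').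
Proof.
rewrite mulrDr addrACA; congr (_ + _).
rewrite mulr_sumr -big_split; apply: eq_bigr => i _ /=.
by rewrite mulrA -rmorphM -mulrDl -rmorphD.
Qed.

Lemma alg_pull (k : fieldType) (A : kalgebra k) c (x y z : A) :
  z * y = x * y -> alg_map A c * (x * y) = z * (alg_map A c * y).
Proof. by move=> <-; rewrite !mulrA alg_central. Qed.

Section SpanMod.
Variables (k : fieldType) (A : kalgebra k) (T : finType) (g : T -> A) (P : A -> Prop).
Hypothesis P_ideal : ideal P.
Definition span_mod (x : A) : Prop :=
  exists c : T -> k, P (x - \sum_t alg_map A (c t) * g t).

Lemma span_modD x y : span_mod x -> span_mod y -> span_mod (x + y).
Proof.
move=> [c hc] [d hd]; exists (fun t => c t + d t).
have -> : \sum_t alg_map A (c t + d t) * g t =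
    \sum_t alg_map A (c t) * g t + \sum_t alg_map A (d t) * g t.
  by rewrite -big_split; apply: eq_bigr => t _; rewrite rmorphD mulrDl.
by rewrite opprD addrACA; have [_ pD _ _] := P_ideal; apply: pD.
Qed.
Lemma span_mod_ideal x : P x -> span_mod x.
Proof.
move=> h; exists (fun=> 0); rewrite big1 ?subr0 // => t _.
by rewrite rmorph0 mul0r.
Qed.
Lemma span_mod_gen c t : span_mod (alg_map A c * g t).
Proof.
exists (fun t' => if t' == t then c else 0); rewrite (bigD1 t) //= eqxx.
rewrite big1 => [|t' /negPf ->]; last by rewrite rmorph0 mul0r.
by rewrite addr0 subrr; have [p0 _ _ _] := P_ideal.
Qed.
End SpanMod.

Section FiniteDimensional.
Variables (k : fieldType) (Q : gentle_quiver k).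
Local Notation I := (@gentle_ideal k Q).
Local Notation B := (quot I).
Local Notation J := (@arrow_ideal k Q).

Let ar (a : arrow Q) : B := quot_pi I (arrow_elt k a).
Let wd (w : seq (arrow Q)) : B := \prod_(b <- rev w) ar b.
Let vx (i : vertex Q) : B := quot_pi I (of_path k (path_vertex i)).

Let ar0 c b : c <> sigma Q b -> ar c * ar b = 0.
Proof.
move=> ne; have [_ _ [S [_ hI]]] := gentleP Q.
have ic : I (arrow_elt k c * arrow_elt k b).
  by apply: contrapT => /sigma_funP e; apply: ne; rewrite permE.
have := (quot_piE I (arrow_elt k c * arrow_elt k b) 0).2.
rewrite rmorphM rmorph0 subr0; apply.
by apply: ideal_genS.
Qed.

Let wd_nil : wd [::] = 1.
Proof. by rewrite /wd big_nil. Qed.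
Let wd_cat u v : wd (u ++ v) = wd v * wd u.
Proof. by rewrite /wd rev_cat big_cat. Qed.
Let wd1 a : wd [:: a] = ar a.
Proof. by rewrite /wd big_seq1. Qed.
Let wd_rcons u a : wd (rcons u a) = ar a * wd u.
Proof. by rewrite -cats1 wd_cat wd1. Qed.
Let wd_cons a u : wd (a :: u) = wd u * ar a.
Proof. by rewrite -cat1s wd_cat wd1. Qed.

Let pi_path (i : vertex Q) w (hw : walk i w) :
  quot_pi I (of_path k (Sub (i, w) hw)) = wd w * vx i.
Proof.
elim/last_ind: w hw => [|w a IH] hw.
  by rewrite wd_nil mul1r; congr (quot_pi I (of_path k _)); apply: val_inj.
have hw' : walk i w by move: hw; rewrite -cats1 walk_cat => /andP[].
rewrite wd_rcons -mulrA -(IH hw') /ar -rmorphM.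
congr (quot_pi I _).
rewrite -[RHS]/(path_mul _ _) of_pathM.
case: (path_comp_spec (path_arrow a) (Sub (i, w) hw')) => [[ne _]|[_ [r [-> _ _ vr]]]].
  case: ne; move: hw; rewrite -cats1 walk_cat /= andbT => /andP[_ /eqP e].
  by rewrite /path_start /path_end /= e.
by congr of_path; apply: val_inj; rewrite vr /= cats1.
Qed.

Let W n (x : B) : Prop := exists s : seq (k * seq (arrow Q)),
  (forall t, t \in s -> (n <= size t.2)%N) /\
  x = \sum_(t <- s) alg_map B t.1 * wd t.2.

Let WD n x y : W n x -> W n y -> W n (x + y).
Proof.
move=> [s [hs ->]] [t [ht ->]]; exists (s ++ t); rewrite big_cat; split=> // u.
by rewrite mem_cat => /orP[/hs|/ht].
Qed.
Let W0 n : W n 0.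
Proof. by exists [::]; rewrite big_nil. Qed.
Let Wwd n c w : (n <= size w)%N -> W n (alg_map B c * wd w).
Proof.
by move=> h; exists [:: (c, w)]; rewrite big_seq1; split=> // t; rewrite inE => /eqP ->.
Qed.
Let Wind n (P : B -> Prop) : P 0 -> (forall x y, P x -> P y -> P (x + y)) ->
  (forall c w, (n <= size w)%N -> P (alg_map B c * wd w)) -> forall x, W n x -> P x.
Proof.
move=> P0 PD Pw x [s [hs ->]]; rewrite big_seq; apply: big_ind => // t ts.
by apply: Pw; apply: hs.
Qed.
Let WS n m x : (m <= n)%N -> W n x -> W m x.
Proof.
move=> le; apply: Wind => [||c w h]; [exact: W0|exact: WD|].
by apply: Wwd; apply: leq_trans h.
Qed.

Let vx_ar i a : vx i * ar a = if i == tgt a then ar a else 0.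
Proof.
rewrite /vx /ar -rmorphM -[_ * _]/(path_mul _ _) of_pathM.
have [[ne ->]|[h [r [-> _ _ vr]]]] := path_comp_spec (path_vertex i) (path_arrow a).
  by rewrite rmorph0; case: eqP.
have -> : (i == tgt a) = true by apply/eqP; exact: h.
by congr (quot_pi I (of_path k _)); apply: val_inj; rewrite vr.
Qed.
Let ar_vx i a : ar a * vx i = if i == src a then ar a else 0.
Proof.
rewrite /vx /ar -rmorphM -[_ * _]/(path_mul _ _) of_pathM.
have [[ne ->]|[h [r [-> _ _ vr]]]] := path_comp_spec (path_arrow a) (path_vertex i).
  by rewrite rmorph0; case: eqP => // h; case: ne.
have -> : (i == src a) = true by apply/eqP; exact: esym h.
congr (quot_pi I (of_path k _)); apply: val_inj; rewrite vr /=.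
by have <- : src a = i := h.
Qed.

Let Wvxl n i x : W n.+1 x -> W n.+1 (vx i * x).
Proof.
apply: (@Wind n.+1 (fun x => W n.+1 (vx i * x))) => [|y z hy hz|c w]; first by rewrite mulr0; apply: W0.
  by rewrite mulrDr; apply: WD.
case/lastP: w => // w a; rewrite mulrA -alg_central -mulrA wd_rcons [vx i * _]mulrA vx_ar.
case: ifP => _ h; last by rewrite mul0r mulr0; apply: W0.
by rewrite -wd_rcons; apply: Wwd.
Qed.
Let Wvxr n i x : W n.+1 x -> W n.+1 (x * vx i).
Proof.
apply: (@Wind n.+1 (fun x => W n.+1 (x * vx i))) => [|y z hy hz|c w]; first by rewrite mul0r; apply: W0.
  by rewrite mulrDl; apply: WD.
case: w => // a w; rewrite -mulrA wd_cons -[wd w * _ * _]mulrA ar_vx.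
case: ifP => _ h; last by rewrite !mulr0; apply: W0.
by rewrite -wd_cons; apply: Wwd.
Qed.

Let WM n m x y : W n x -> W m y -> W (n + m)%N (x * y).
Proof.
move=> hx hy; move: x hx; apply: (@Wind n (fun x => W (n + m)%N (x * y))) => [|x z hx hz|c u hu].
- by rewrite mul0r; apply: W0.
- by rewrite mulrDl; apply: WD.
move: y hy; apply: (@Wind m (fun y => W (n + m)%N (alg_map B c * wd u * y))) => [|x z hx hz|d v hv].
- by rewrite mulr0; apply: W0.
- by rewrite mulrDr; apply: WD.
rewrite alg_mulACA -wd_cat; apply: Wwd.
by rewrite size_cat addnC leq_add.
Qed.

Let span (x : B) : exists (d : vertex Q -> k) y,
  W 1 y /\ x = \sum_i alg_map B (d i) * vx i + y.
Proof.
have [f ->] := quot_pi_surj x; elim/path_ring_ind: f => [|p|c f g].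
- exists (fun=> 0), 0; split; first exact: W0.
  by rewrite rmorph0 addr0 big1 // => i _; rewrite rmorph0 mul0r.
- case: p => [[i w] hw].
  have -> : quot_pi I (of_path k (exist _ (i, w) hw)) = wd w * vx i by apply: pi_path.
  case: w {hw} => [|a w].
    exists (fun j => (i == j)%:R), 0; split; first exact: W0.
    rewrite wd_nil mul1r addr0 (bigD1 i) //= eqxx rmorph1 mul1r big1 ?addr0 // => j.
    by rewrite eq_sym => /negPf ->; rewrite rmorph0 mul0r.
  exists (fun=> 0), (wd (a :: w) * vx i); split.
    apply: Wvxr; rewrite -[wd _]mul1r -(rmorph1 (alg_map B)); exact: Wwd.
  by rewrite big1 ?add0r // => j _; rewrite rmorph0 mul0r.
move=> [d [y [hy ey]]] [d' [y' [hy' ey']]].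
exists (fun i => c * d i + d' i), (alg_map B c * y + y'); split.
  apply: WD => //; have := @WM 0%N 1%N (alg_map B c) y.
  rewrite add0n; apply=> //; rewrite -[alg_map B c]mulr1 -wd_nil; exact: Wwd.
have -> : quot_pi I (c *: f + g) = alg_map B c * quot_pi I f + quot_pi I g.
  rewrite rmorphD /=; congr (_ + _); rewrite -rmorphM; congr (quot_pi I _).
  by rewrite /path_const -path_scalerAl mul1r.
by rewrite ey ey'; apply: alg_sum_lin.
Qed.

Let W_ideal n : ideal (W n.+1).
Proof.
split; [exact: W0|exact: WD| |].
- move=> a x hx; have [d [y [hy ->]]] := span a; rewrite mulrDl; apply: WD.
    rewrite mulr_suml; apply: (big_ind (W n.+1)); [exact: W0|exact: WD|] => i _.
    rewrite -mulrA; have := @WM 0%N n.+1 (alg_map B (d i)) (vx i * x).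
    rewrite add0n; apply; last exact: Wvxl.
    rewrite -[alg_map B _]mulr1 -wd_nil; exact: Wwd.
  by apply: (@WS (1 + n.+1)%N) => //; apply: WM.
- move=> a x hx; have [d [y [hy ->]]] := span a; rewrite mulrDr; apply: WD.
    rewrite mulr_sumr; apply: (big_ind (W n.+1)); [exact: W0|exact: WD|] => i _.
    rewrite mulrA -(alg_central (d i) x) -mulrA.
    have := @WM 0%N n.+1 (alg_map B (d i)) (x * vx i).
    rewrite add0n; apply; last exact: Wvxr.
    rewrite -[alg_map B _]mulr1 -wd_nil; exact: Wwd.
  by apply: (@WS (n.+1 + 1)%N); [rewrite addn1|apply: WM].
Qed.

Let JW n x : (0 < n)%N -> ideal_pow J n x -> W n x.
Proof.
have J1 y : J y -> W 1 y.
  move=> h; apply: (h _ (W_ideal 0)) => z [a ->].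
  rewrite -/(ar a) -wd1 -[wd _]mul1r -(rmorph1 (alg_map B)); exact: Wwd.
elim: n x => // n IH x _ h.
apply: (h _ (W_ideal n)) => z [a [b [ha hb ->]]].
case: n IH hb {h} => [_ _|n IH hb]; last by apply: (@WM 1%N n.+1); [apply: J1|apply: IH].
by have [_ _ _ h] := W_ideal 0; apply: h; apply: J1.
Qed.

Let pow_ideal n : ideal (ideal_pow J n).
Proof. by case: n => [|n]; [split | apply: ideal_gen_ideal]. Qed.

Let wdJ w n : (n <= size w)%N -> ideal_pow J n (wd w).
Proof.
elim/last_ind: w n => [|w a IH] [|n] //.
rewrite size_rcons ltnS => h; rewrite wd_rcons; apply: ideal_genS.
exists (ar a), (wd w); split=> //; last exact: IH.
by apply: ideal_genS; exists a.
Qed.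

Let WJ n x : W n x -> ideal_pow J n x.
Proof.
have [p0 pD pl pr] := pow_ideal n.
apply: Wind => // c w h; apply: pl; exact: wdJ.
Qed.

Variable m : {set arrow Q} -> nat.
Hypothesis m_gt0 : forall v, v \in porbits (sigma Q) -> (0 < m v)%N.

Let e a := (m (porbit (sigma Q) a) * #|porbit (sigma Q) a|)%N.
Let e_gt0 a : (0 < e a)%N.
Proof.
rewrite muln_gt0 m_gt0 ?imset_f //=.
by apply/card_gt0P; exists a; apply: porbit_id.
Qed.
Let z0 : B := \sum_a wd (traject (sigma Q) a (e a)).

Let traj_add a i j :
  traject (sigma Q) a (i + j) =
  traject (sigma Q) a i ++ traject (sigma Q) (iter i (sigma Q) a) j.
Proof. by rewrite trajectD. Qed.

Let cyc_pow a :
  cyclic_path a ^+ m (porbit (sigma Q) a) =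
  completion_map J (wd (traject (sigma Q) a (e a))).
Proof.
rewrite /e; set n := #|porbit _ a|.
have per : iter n (sigma Q) a = a by rewrite /n iter_porbit.
have hc : cyclic_path a = completion_map J (wd (traject (sigma Q) a n)).
  rewrite /cyclic_path /wd rmorph_prod; exact: eq_bigr.
elim: (m _) => [|j IH]; first by rewrite expr0 mul0n wd_nil rmorph1.
by rewrite exprSr IH hc -rmorphM mulSn traj_add per wd_cat.
Qed.

Let z0E : central_elt m = completion_map J z0.
Proof. by rewrite /central_elt /z0 raddf_sum; apply: eq_bigr => a _; apply: cyc_pow. Qed.

Let wd_traj w : wd w <> 0 -> forall a, w = traject (sigma Q) (head a w) (size w).
Proof.
elim/last_ind: w => [|w b IH] // ne a.
case/lastP: w IH ne => [|w c] IH ne //.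
have ne' : wd (rcons w c) <> 0 by move=> h; apply: ne; rewrite wd_rcons h mulr0.
have eb : b = sigma Q c.
  apply: contrapT => nb; apply: ne.
  by rewrite !wd_rcons mulrA (ar0 nb) mul0r.
have := IH ne' a; rewrite !size_rcons.
have -> : head a (rcons (rcons w c) b) = head a (rcons w c) by case: (w).
set h := head _ _ => ew.
rewrite trajectSr -ew; congr rcons.
rewrite eb; move: ew; rewrite trajectSr => /rcons_inj[_ ->].
by rewrite -iterS.
Qed.

Let L := (\max_a e a).+1.

Let z_div n x : (L <= n)%N -> W n x -> exists u, W (n - L).+1 u /\ x = z0 * u.
Proof.
move=> Ln; apply: (@Wind n (fun x => exists u, W (n - L).+1 u /\ x = z0 * u)) => [|_ _ [u [hu ->]] [v [hv ->]]|c w hw].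
- by exists 0; rewrite mulr0; split=> //; apply: W0.
- by exists (u + v); rewrite mulrDr; split=> //; apply: WD.
case: (pselect (wd w = 0)) => [->|/wd_traj ht].
  by exists 0; rewrite !mulr0; split=> //; apply: W0.
case: w hw ht => [|a w] hw; first by have := leq_trans Ln hw; rewrite ltn0.
move=> /(_ a) ht0; pose l := size w.
have {ht0} ht : a :: w = traject (sigma Q) a l.+1 := ht0.
have lea : (e a < L)%N by rewrite ltnS /L (leq_bigmax a).
have lel : (e a < l.+1)%N by apply: leq_trans lea (leq_trans Ln hw).
pose j := (l - e a)%N; have lE : l.+1 = (j.+1 + e a)%N by rewrite addSn subnK.
rewrite lE traj_add in ht.
set b := iter j.+1 (sigma Q) a.
have eb : e b = e a.
  rewrite /e; suff -> : porbit (sigma Q) b = porbit (sigma Q) a by [].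
  by apply/eqP; rewrite eq_porbit_mem /b -permX mem_porbit.
exists (alg_map B c * wd (traject (sigma Q) a j.+1)); split.
  apply: Wwd; rewrite size_traject.
  have h1 : (n <= j.+1 + e a)%N by rewrite -lE.
  rewrite -(leq_add2r (e a)); apply: leq_trans h1.
  rewrite -[X in (_ <= X)%N](subnK Ln) addSnnS leq_add2l.
  exact: lea.
rewrite ht wd_cat; apply: alg_pull.
rewrite /z0 mulr_suml (bigD1 b) //= eb big1 ?addr0 // => d db.
have := e_gt0 d; case: (e d) => // f _.
have -> : traject (sigma Q) d f.+1 = d :: traject (sigma Q) (sigma Q d) f by [].
have -> : a :: traject (sigma Q) (sigma Q a) j = rcons (traject (sigma Q) a j) (iter j (sigma Q) a).
  by rewrite -trajectSr.
rewrite (wd_cons d) -mulrA wd_rcons [ar d * _]mulrA ar0 ?mul0r ?mulr0 //.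
by move=> dE; move/eqP: db; apply; rewrite dE.
Qed.

Local Notation A := (twisted_brauer_graph_algebra m).
Local Notation Lam := (gentle_algebra Q).

Let zJ n x : ideal_pow J (L + n) x -> exists u, ideal_pow J n u /\ x = z0 * u.
Proof.
move=> hx; have h : W (L + n)%N x by apply: JW.
have [u [hu ->]] := z_div (leq_addr n L) h.
exists u; split=> //; apply: WJ; apply: WS hu.
by rewrite addKn.
Qed.

Let powS n x : ideal_pow J n.+1 x -> ideal_pow J n x.
Proof.
move=> h; apply: (h _ (pow_ideal n)) => y [a [b [_ hb ->]]].
by have [_ _ pl _] := pow_ideal n; apply: pl.
Qed.

Let powW n j x : ideal_pow J (n + j) x -> ideal_pow J n x.
Proof. by elim: j => [|j IH]; [rewrite addn0 | rewrite addnS => /powS]. Qed.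

Let lev_eq n x y :
  quot_pi (ideal_pow J n) x = quot_pi (ideal_pow J n) y <-> ideal_pow J n (x - y).
Proof.
split=> [/quot_piE h|h]; first exact: (h _ (pow_ideal n)).
by apply/quot_piE; apply: ideal_genS.
Qed.

Let z_divides (y : Lam) : level y L = 0 -> exists v, y = central_elt m * v.
Proof.
move=> yL.
pose r n := projT1 (cid (level_compat y n)).
have rE n : level y n.+1 = quot_pi _ (r n) /\ level y n = quot_pi _ (r n).
  by rewrite /r; case: (cid _).
have dr n : ideal_pow J n.+1 (r n.+1 - r n).
  by apply/lev_eq; rewrite -(rE n.+1).2 -(rE n).1.
pose d n := if n is n'.+1 then r (L + n'.+1)%N - r (L + n')%N else r (L + 0)%N.
have dJ n : ideal_pow J (L + n)%N (d n).
  case: n => [|n]; last by have := dr (L + n)%N; rewrite /d addnS.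
  rewrite /d.
  rewrite -[r _]subr0; apply/lev_eq.
  rewrite rmorph0; apply: etrans (esym (rE (L + 0)%N).2) _.
  by rewrite addn0.
pose u n := projT1 (cid (zJ (dJ n))).
have uE n : ideal_pow J n (u n) /\ d n = z0 * u n by rewrite /u; case: (cid _).
pose v n : quot_ring (ideal_pow J n) := quot_pi _ (\sum_(j < n) u j).
have vc n : exists r, v n.+1 = quot_pi _ r /\ v n = quot_pi _ r.
  exists (\sum_(j < n.+1) u j); split=> //.
  apply/lev_eq; rewrite big_ord_recr /= opprD addrA subrr add0r.
  exact: (idealN (pow_ideal n) (uE n).1).
exists (Completion vc); rewrite z0E; apply: completion_eq => n.
apply: etrans _ (rmorphM (quot_pi (ideal_pow J n)) z0 (\sum_(j < n) u j)).
rewrite mulr_sumr.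
case: n => [|n].
  have [x ->] := quot_pi_surj (level y 0%N).
  by apply/lev_eq.
have -> : \sum_(j < n.+1) z0 * u j = r (L + n)%N.
  elim: n => [|n IH]; first by rewrite big_ord1 -(uE 0%N).2.
  by rewrite big_ord_recr IH /= -(uE n.+1).2 /= addrC subrK.
have yk j : level y n.+1 = quot_pi _ (r (n + j)%N).
  elim: j => [|j IH]; first by rewrite addn0 (rE n).1.
  rewrite IH addnS; apply: esym; apply/lev_eq.
  by apply: (@powW _ j); rewrite addSn; apply: dr.
by rewrite (yk L) addnC.
Qed.

Let T : finType := (vertex Q + {i : 'I_L & i.-tuple (arrow Q)})%type.
Let g (t : T) : B := match t with inl i => vx i | inr p => wd (tagged p) end.
Let V : B -> Prop := @span_mod k B T g (ideal_pow J L).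

Let VD x y : V x -> V y -> V (x + y).
Proof. exact: (@span_modD k B T g (ideal_pow J L) (pow_ideal L) x y). Qed.
Let V0 : V 0.
Proof.
by apply: (@span_mod_ideal k B T g (ideal_pow J L)); case: (pow_ideal L).
Qed.
Let Vg c t : V (alg_map B c * g t).
Proof. exact: (@span_mod_gen k B T g (ideal_pow J L) (pow_ideal L) c t). Qed.
Let VJ x : ideal_pow J L x -> V x.
Proof. exact: (@span_mod_ideal k B T g (ideal_pow J L) x). Qed.
Let V_all x : V x.
Proof.
have [d [y [[s [_ ->]] ->]]] := span x; apply: VD.
  by apply: (big_ind V) => // i _; apply: (Vg (d i) (inl i)).
apply: (big_ind V) => // -[c w] _ /=.
case: (ltnP (size w) L) => h; last by apply: VJ; apply: WJ; apply: Wwd.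
exact: (Vg c (inr (Tagged (fun i : 'I_L => i.-tuple (arrow Q))
  (in_tuple w : (Ordinal h).-tuple (arrow Q))))).
Qed.

Lemma tbga_finite_dimensional : finite_dimensional A.
Proof.
pose pr (x : B) : A := quot_pi _ (completion_map J x).
suff h (x : A) : exists c : T -> k, x = \sum_t alg_map A (c t) * pr (g t).
  exists #|T|, (fun i => pr (g (enum_val i))) => x; have [c ->] := h x.
  exists (c \o enum_val).
  by apply: (reindex _ (onW_bij _ (enum_val_bij T))).
have [X ->] := quot_pi_surj x; have [r hr] := quot_pi_surj (level X L).
have [c hc] := V_all r; exists c.
set b : B := \sum_t alg_map B (c t) * g t.
have hb : \sum_t alg_map A (c t) * pr (g t) = pr b.
  rewrite /pr /b !rmorph_sum; apply: eq_bigr => t _.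
  by rewrite (rmorphM (completion_map J)) rmorphM.
rewrite hb /pr; apply/quot_piE; apply: ideal_genS; apply: z_divides.
rewrite -[level _ L]/(level X L - quot_pi _ b) hr -rmorphB.
by rewrite -(rmorph0 (quot_pi (ideal_pow J L))); apply/lev_eq; rewrite subr0.
Qed.
End FiniteDimensional.

(* Categories with hom-setoids: heq is the equality of morphisms. *)
Record category := Category {
  ob :> Type;
  hom : ob -> ob -> Type;
  heq : forall X Y, hom X Y -> hom X Y -> Prop;
  idm : forall X, hom X X;
  compose : forall X Y Z, hom Y Z -> hom X Y -> hom X Z;
  heq_refl : forall X Y (f : hom X Y), heq f f;
  heq_sym : forall X Y (f g : hom X Y), heq f g -> heq g f;
  heq_trans : forall X Y (f g h : hom X Y), heq f g -> heq g h -> heq f h;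
  compose_heq : forall X Y Z (f f' : hom Y Z) (g g' : hom X Y),
    heq f f' -> heq g g' -> heq (compose f g) (compose f' g');
  comp1m : forall X Y (f : hom X Y), heq (compose (idm Y) f) f;
  compm1 : forall X Y (f : hom X Y), heq (compose f (idm X)) f;
  compA : forall X Y Z T (f : hom Z T) (g : hom Y Z) (h : hom X Y),
    heq (compose f (compose g h)) (compose (compose f g) h) }.

Record functor (C D : category) := Functor {
  fob :> C -> D;
  fhom : forall X Y, hom X Y -> hom (fob X) (fob Y);
  fhom_heq : forall X Y (f g : hom X Y), heq f g -> heq (fhom f) (fhom g);
  fhom1 : forall X, heq (fhom (idm X)) (idm (fob X));
  fhom_comp : forall X Y Z (f : hom Y Z) (g : hom X Y),
    heq (fhom (compose f g)) (compose (fhom f) (fhom g)) }.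

Definition id_functor (C : category) : functor C C :=
  @Functor C C id (fun _ _ f => f) (fun _ _ _ _ e => e)
    (fun X => heq_refl (idm X)) (fun _ _ _ f g => heq_refl (compose f g)).

Section CompFunctor.
Variables (C D E : category) (G : functor D E) (F : functor C D).
Lemma comp_functor1 X : heq (fhom G (fhom F (idm X))) (idm (G (F X))).
Proof. exact: heq_trans (fhom_heq G (fhom1 F X)) (fhom1 G (F X)). Qed.
Lemma comp_functorM X Y Z (f : hom Y Z) (g : hom X Y) :
  heq (fhom G (fhom F (compose f g))) (compose (fhom G (fhom F f)) (fhom G (fhom F g))).
Proof. exact: heq_trans (fhom_heq G (fhom_comp F f g)) (fhom_comp G _ _). Qed.
Definition comp_functor : functor C E :=
  @Functor C E (fun X => G (F X)) (fun X Y f => fhom G (fhom F f))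
    (fun X Y f g e => fhom_heq G (fhom_heq F e)) comp_functor1 comp_functorM.
End CompFunctor.

Record nat_trans (C D : category) (F G : functor C D) := NatTrans {
  ntrans :> forall X, hom (F X) (G X);
  ntrans_nat : forall X Y (f : hom X Y),
    heq (compose (ntrans Y) (fhom F f)) (compose (fhom G f) (ntrans X)) }.

Definition isomorphism (C : category) (X Y : C) (f : hom X Y) : Prop :=
  exists g : hom Y X, heq (compose g f) (idm X) /\ heq (compose f g) (idm Y).

Definition isomorphic (C : category) (X Y : C) : Prop :=
  exists f : hom X Y, isomorphism f.

Definition functor_iso (C D : category) (F G : functor C D) : Prop :=
  exists t : nat_trans F G, forall X, isomorphism (t X).

Section FullSubcategory.
Variables (C : category) (P : C -> Prop).
Definition full_subcategory : category :=
  @Category {X : C | P X} (fun X Y => hom (sval X) (sval Y))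
    (fun X Y => @heq C (sval X) (sval Y)) (fun X => idm (sval X))
    (fun X Y Z f g => compose f g) (fun X Y => @heq_refl C _ _)
    (fun X Y => @heq_sym C _ _) (fun X Y => @heq_trans C _ _)
    (fun X Y Z => @compose_heq C _ _ _) (fun X Y => @comp1m C _ _)
    (fun X Y => @compm1 C _ _) (fun X Y Z T => @compA C _ _ _ _).

Definition preserves (F : functor C C) : Prop := forall X, P X -> P (F X).

Definition restrict (F : functor C C) (PF : preserves F) :
    functor full_subcategory full_subcategory :=
  @Functor full_subcategory full_subcategory
    (fun X => exist _ (F (sval X)) (PF _ (svalP X)))
    (fun X Y f => fhom F f) (fun X Y f g e => fhom_heq F e)
    (fun X => fhom1 F (sval X)) (fun X Y Z f g => fhom_comp F f g).
End FullSubcategory.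

(* The Gabriel-Zisman localization of C at W: morphisms are formal composites of
   morphisms of C and of formal inverses of elements of W, modulo the congruence
   generated by the relations of C and by the invertibility of W. *)
Section Localization.
Variables (C : category) (W : forall X Y : C, hom X Y -> Prop).

Inductive loc_hom : C -> C -> Type :=
| loc_fwd X Y (f : hom X Y) : loc_hom X Y
| loc_inv X Y (s : hom X Y) (Ws : W s) : loc_hom Y X
| loc_comp X Y Z (f : loc_hom Y Z) (g : loc_hom X Y) : loc_hom X Z.

Inductive loc_heq : forall X Y, loc_hom X Y -> loc_hom X Y -> Prop :=
| loc_refl X Y (f : loc_hom X Y) : loc_heq f f
| loc_sym X Y (f g : loc_hom X Y) : loc_heq f g -> loc_heq g f
| loc_trans X Y (f g h : loc_hom X Y) :
    loc_heq f g -> loc_heq g h -> loc_heq f h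
| loc_comp_heq X Y Z (f f' : loc_hom Y Z) (g g' : loc_hom X Y) :
    loc_heq f f' -> loc_heq g g' -> loc_heq (loc_comp f g) (loc_comp f' g')
| loc_comp1m X Y (f : loc_hom X Y) : loc_heq (loc_comp (loc_fwd (idm Y)) f) f
| loc_compm1 X Y (f : loc_hom X Y) : loc_heq (loc_comp f (loc_fwd (idm X))) f
| loc_compA X Y Z T (f : loc_hom Z T) (g : loc_hom Y Z) (h : loc_hom X Y) :
    loc_heq (loc_comp f (loc_comp g h)) (loc_comp (loc_comp f g) h)
| loc_fwd_heq X Y (f g : hom X Y) : heq f g -> loc_heq (loc_fwd f) (loc_fwd g)
| loc_fwd_comp X Y Z (f : hom Y Z) (g : hom X Y) :
    loc_heq (loc_fwd (compose f g)) (loc_comp (loc_fwd f) (loc_fwd g))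
| loc_invl X Y (s : hom X Y) (Ws : W s) :
    loc_heq (loc_comp (loc_inv Ws) (loc_fwd s)) (loc_fwd (idm X))
| loc_invr X Y (s : hom X Y) (Ws : W s) :
    loc_heq (loc_comp (loc_fwd s) (loc_inv Ws)) (loc_fwd (idm Y)).

Definition localization : category :=
  @Category C loc_hom loc_heq (fun X => loc_fwd (idm X)) loc_comp
    loc_refl loc_sym loc_trans loc_comp_heq loc_comp1m loc_compm1 loc_compA.

Definition loc_functor : functor C localization :=
  @Functor C localization id loc_fwd loc_fwd_heq
    (fun X => loc_refl (loc_fwd (idm X))) loc_fwd_comp.
End Localization.

Section InducedFunctor.
Variables (C : category) (W : forall X Y : C, hom X Y -> Prop) (F : functor C C).
Hypothesis FW : forall X Y (s : hom X Y), W s -> W (fhom F s).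

Fixpoint induced_hom X Y (f : loc_hom W X Y) : loc_hom W (F X) (F Y) :=
  match f in loc_hom _ X Y return loc_hom W (F X) (F Y) with
  | loc_fwd _ _ f => loc_fwd W (fhom F f)
  | loc_inv _ _ _ Ws => loc_inv (FW Ws)
  | loc_comp _ _ _ f g => loc_comp (induced_hom f) (induced_hom g)
  end.

Lemma induced_heq X Y (f g : loc_hom W X Y) :
  loc_heq f g -> loc_heq (induced_hom f) (induced_hom g).
Proof.
have fwd1 Z : loc_heq (loc_fwd W (fhom F (idm Z))) (loc_fwd W (idm (F Z))).
  by apply: loc_fwd_heq; apply: fhom1.
elim=> {X Y f g} /=.
- by move=> *; apply: loc_refl.
- by move=> *; apply: loc_sym.
- by move=> X Y f g h _ fg _ gh; apply: loc_trans fg gh.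
- by move=> *; apply: loc_comp_heq.
- move=> X Y f; apply: loc_trans (loc_comp1m _).
  exact: loc_comp_heq (fwd1 Y) (loc_refl _).
- move=> X Y f; apply: loc_trans (loc_compm1 _).
  exact: loc_comp_heq (loc_refl _) (fwd1 X).
- by move=> *; apply: loc_compA.
- by move=> *; apply: loc_fwd_heq; apply: fhom_heq.
- move=> X Y Z f g; apply: loc_trans (loc_fwd_comp _ _ _).
  by apply: loc_fwd_heq; apply: fhom_comp.
- by move=> X Y s Ws; apply: loc_trans (loc_invl (FW Ws)) (loc_sym (fwd1 X)).
- by move=> X Y s Ws; apply: loc_trans (loc_invr (FW Ws)) (loc_sym (fwd1 Y)).
Qed.

Lemma induced1 X : loc_heq (induced_hom (loc_fwd W (idm X))) (loc_fwd W (idm (F X))).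
Proof. by apply: loc_fwd_heq; apply: fhom1. Qed.

Definition induced_functor : functor (localization W) (localization W) :=
  @Functor (localization W) (localization W) F induced_hom induced_heq induced1
    (fun X Y Z f g => loc_refl _).
End InducedFunctor.

(* The total left derived functor of F: the functor L, with a natural
   transformation L Q => Q F, which is terminal among such pairs, where Q is the
   localization functor (the right Kan extension of Q F along Q). *)
Record left_derived (C : category) (W : forall X Y : C, hom X Y -> Prop)
    (F : functor C C) := LeftDerived {
  derived_functor :> functor (localization W) (localization W);
  derived_counit : nat_trans (comp_functor derived_functor (loc_functor W))
                             (comp_functor (loc_functor W) F);
  derived_univ : forall (G : functor (localization W) (localization W))
      (t : nat_trans (comp_functor G (loc_functor W))
                     (comp_functor (loc_functor W) F)),
    let lifts (u : nat_trans G derived_functor) :=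
      forall X : C, heq (compose (derived_counit X) (u X)) (t X) in
    exists u, lifts u /\ forall v, lifts v -> forall X, heq (u X) (v X) }.

Definition finitely_generated (R : pzRingType) (M : lmodType R) : Prop :=
  exists n (g : 'I_n -> M), forall x, exists c : 'I_n -> R,
    x = \sum_(i < n) c i *: g i.

Lemma finitely_generatedP (R : pzRingType) (M : lmodType R) (T : finType) (g : T -> M) :
  (forall x, exists c : T -> R, x = \sum_t c t *: g t) -> finitely_generated M.
Proof.
move=> h; exists #|T|, (g \o enum_val) => x; have [c ->] := h x.
exists (c \o enum_val); apply: reindex; exact: onW_bij (enum_val_bij T).
Qed.

(* R-R-bimodules; the left action is the module structure of bimod. *)
Record bimodule (R : pzRingType) := Bimodule {
  bimod :> lmodType R;
  ract : bimod -> R -> bimod;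
  ract_addl : forall x y a, ract (x + y) a = ract x a + ract y a;
  ract_addr : forall x a b, ract x (a + b) = ract x a + ract x b;
  ract1 : forall x, ract x 1 = x;
  ractM : forall x a b, ract x (a * b) = ract (ract x a) b;
  ractZ : forall a x b, ract (a *: x) b = a *: ract x b }.

(* The tensor product over R: formal sums of pairs, two of which are identified
   when every balanced map takes the same value on them. *)
Section Tensor.
Variables (R : pzRingType) (X : bimodule R) (M : lmodType R).

Definition balanced (G : zmodType) (f : X -> M -> G) : Prop :=
  [/\ forall x y m, f (x + y) m = f x m + f y m,
      forall x m n, f x (m + n) = f x m + f x n &
      forall x a m, f (ract x a) m = f x (a *: m)].

Definition formal_eval (G : zmodType) (f : X -> M -> G) (s : seq (X * M)) : G :=
  \sum_(t <- s) f t.1 t.2.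

Definition tensor_rel (s t : seq (X * M)) : bool :=
  `[< forall (G : zmodType) (f : X -> M -> G),
        balanced f -> formal_eval f s = formal_eval f t >].

Lemma tensor_rel_refl : reflexive tensor_rel.
Proof. by move=> s; apply/asboolP. Qed.
Lemma tensor_rel_sym : symmetric tensor_rel.
Proof.
by move=> s t; apply/asboolP/asboolP => h G f hf; rewrite (h G f hf).
Qed.
Lemma tensor_rel_trans : transitive tensor_rel.
Proof.
move=> t s u /asboolP h1 /asboolP h2; apply/asboolP => G f hf.
by rewrite (h1 G f hf) (h2 G f hf).
Qed.

Canonical tensor_equiv :=
  EquivRel tensor_rel tensor_rel_refl tensor_rel_sym tensor_rel_trans.

Definition tensor := {eq_quot tensor_equiv}.
HB.instance Definition _ := EqQuotient.on tensor.
HB.instance Definition _ := Choice.on tensor.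

Definition formal (s : seq (X * M)) : tensor := \pi s.
Definition pure_tensor (x : X) (m : M) : tensor := formal [:: (x, m)].

Lemma formalE s t : formal s = formal t <->
  forall (G : zmodType) (f : X -> M -> G),
    balanced f -> formal_eval f s = formal_eval f t.
Proof.
split=> [/eqP|h]; first by rewrite eqmodE => /asboolP.
by apply/eqP; rewrite eqmodE; apply/asboolP.
Qed.

Lemma formal_repr (u : tensor) : formal (repr u) = u.
Proof. exact: reprK. Qed.

Lemma formal_surj (u : tensor) : exists s, u = formal s.
Proof. by exists (repr u); rewrite formal_repr. Qed.

Let evalN (G : zmodType) (f : X -> M -> G) (s : seq (X * M)) : balanced f ->
  formal_eval f [seq (- t.1, t.2) | t <- s] = - formal_eval f s.
Proof.
case=> fD _ _; rewrite /formal_eval big_map /= -sumrN; apply: eq_bigr => t _.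
apply/eqP; rewrite -addr_eq0 -fD addNr.
by rewrite -(addrK (f 0 t.2) (f 0 t.2)) -fD addr0 subrr.
Qed.

Let evalZ (G : zmodType) (f : X -> M -> G) (s : seq (X * M)) (a : R) :
  formal_eval f [seq (a *: t.1, t.2) | t <- s] =
  formal_eval (fun x m => f (a *: x) m) s.
Proof. by rewrite /formal_eval big_map. Qed.

Let balZ (G : zmodType) (f : X -> M -> G) (a : R) :
  balanced f -> balanced (fun x m => f (a *: x) m).
Proof.
case=> fDl fDr fA; split=> [x y m|x m n|x b m].
- by rewrite scalerDr fDl.
- by rewrite fDr.
- by rewrite -ractZ fA.
Qed.

Let add (u v : tensor) : tensor := formal (repr u ++ repr v).
Let opp (u : tensor) : tensor := formal [seq (- t.1, t.2) | t <- repr u].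
Let scale (a : R) (u : tensor) : tensor :=
  formal [seq (a *: t.1, t.2) | t <- repr u].

Let eval_cat (G : zmodType) (f : X -> M -> G) s t :
  formal_eval f (s ++ t) = formal_eval f s + formal_eval f t.
Proof. by rewrite /formal_eval big_cat. Qed.

Let reprE s (G : zmodType) (f : X -> M -> G) : balanced f ->
  formal_eval f (repr (formal s)) = formal_eval f s.
Proof. by move: G f; apply/formalE; rewrite formal_repr. Qed.

Let addE s t : add (formal s) (formal t) = formal (s ++ t).
Proof. by apply/formalE => G f hf; rewrite !eval_cat !reprE. Qed.
Let oppE s : opp (formal s) = formal [seq (- t.1, t.2) | t <- s].
Proof. by apply/formalE => G f hf; rewrite !evalN // reprE. Qed.
Let scaleE a s : scale a (formal s) = formal [seq (a *: t.1, t.2) | t <- s].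
Proof.
by apply/formalE => G f hf; rewrite !evalZ reprE //; apply: balZ.
Qed.

Let addA : associative add.
Proof.
move=> u v w.
have [[[s ->] [t ->]] [r ->]] := (formal_surj u, formal_surj v, formal_surj w).
by rewrite !addE catA.
Qed.
Let addC : commutative add.
Proof.
move=> u v; have [[s ->] [t ->]] := (formal_surj u, formal_surj v).
by rewrite !addE; apply/formalE => G f hf; rewrite !eval_cat addrC.
Qed.
Let add0 : left_id (formal [::]) add.
Proof. by move=> u; have [s ->] := formal_surj u; rewrite addE. Qed.
Let addN : left_inverse (formal [::]) opp add.
Proof.
move=> u; have [s ->] := formal_surj u; rewrite oppE addE.
apply/formalE => G f hf.
by rewrite eval_cat evalN // addNr /formal_eval big_nil.
Qed.
HB.instance Definition _ := GRing.isZmodule.Build tensor addA addC add0 addN.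

Lemma formal_cat s t : formal (s ++ t) = formal s + formal t.
Proof. by rewrite -addE. Qed.

Let scaleA a b u : scale a (scale b u) = scale (a * b) u.
Proof.
have [s ->] := formal_surj u; rewrite !scaleE -map_comp.
by congr formal; apply: eq_map => t /=; rewrite scalerA.
Qed.
Let scale1 : left_id 1 scale.
Proof.
move=> u; have [s ->] := formal_surj u; rewrite scaleE.
by congr formal; rewrite -[RHS]map_id; apply: eq_map => -[x m] /=; rewrite scale1r.
Qed.
Let scaleDr : right_distributive scale +%R.
Proof.
move=> a u v; have [[s ->] [t ->]] := (formal_surj u, formal_surj v).
by rewrite -formal_cat !scaleE -formal_cat map_cat.
Qed.
Let scaleDl u : {morph scale^~ u : a b / a + b}.
Proof.
move=> a b; have [s ->] := formal_surj u; rewrite !scaleE -formal_cat.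
apply/formalE => G f hf; have [fD _ _] := hf.
rewrite eval_cat !evalZ /formal_eval -big_split; apply: eq_bigr => t _ /=.
by rewrite scalerDl fD.
Qed.
HB.instance Definition _ :=
  GRing.Zmodule_isLmodule.Build R tensor scaleA scale1 scaleDr scaleDl.

Lemma formal_scale a s : a *: formal s = formal [seq (a *: t.1, t.2) | t <- s].
Proof. by rewrite -scaleE. Qed.

Lemma formal_sum s : formal s = \sum_(t <- s) pure_tensor t.1 t.2.
Proof.
elim: s => [|[x m] s IH]; first by rewrite big_nil.
by rewrite big_cons -IH -formal_cat.
Qed.

Lemma pure_balanced : balanced pure_tensor.
Proof.
split=> *; rewrite -?formal_cat; apply/formalE => G f [fDl fDr fA];
by rewrite /formal_eval /= !(big_cons, big_nil) /= ?addr0 ?fDl ?fDr ?fA.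
Qed.

Lemma pure_scale a x m : a *: pure_tensor x m = pure_tensor (a *: x) m.
Proof. exact: formal_scale. Qed.

Definition tensor_lift (G : zmodType) (f : X -> M -> G) (u : tensor) : G :=
  formal_eval f (repr u).

Lemma tensor_liftE (G : zmodType) (f : X -> M -> G) s : balanced f ->
  tensor_lift f (formal s) = formal_eval f s.
Proof. exact: reprE. Qed.
End Tensor.

Section TensorMap.
Variables (R : pzRingType) (X : bimodule R) (M N : lmodType R) (h : {linear M -> N}).

Definition tensor_map (u : tensor X M) : tensor X N :=
  tensor_lift (fun x m => pure_tensor x (h m)) u.

Let bal : balanced (fun x m => pure_tensor x (h m) : tensor X N).
Proof.
have [pDl pDr pA] := pure_balanced X N.
split=> [x y m|x m n|x a m]; first exact: pDl.
- by rewrite raddfD pDr.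
- by rewrite linearZ pA.
Qed.

Lemma tensor_map_formal s :
  tensor_map (formal s) = formal [seq (t.1, h t.2) | t <- s].
Proof.
by rewrite /tensor_map tensor_liftE ?(formal_sum, big_map).
Qed.

Lemma tensor_map_linear : linear tensor_map.
Proof.
move=> a u v; have [[s ->] [t ->]] := (formal_surj u, formal_surj v).
rewrite formal_scale -formal_cat !tensor_map_formal formal_scale -formal_cat.
by rewrite map_cat -!map_comp.
Qed.
HB.instance Definition _ :=
  GRing.isLinear.Build R (tensor X M) (tensor X N) _ tensor_map tensor_map_linear.
End TensorMap.
Arguments tensor_map {R} X {M N} h u.

Lemma tensor_fg (R : pzRingType) (X : bimodule R) (M : lmodType R) :
  finitely_generated X -> finitely_generated M -> finitely_generated (tensor X M).
Proof.
case=> p [g hg] [q [h hh]].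
pose G (t : 'I_p * 'I_q) : tensor X M := pure_tensor (g t.1) (h t.2).
apply: (@finitely_generatedP _ _ _ G) => u; have [s ->] := formal_surj u.
have [pDl pDr pA] := pure_balanced X M.
rewrite formal_sum; apply: (big_ind (fun v => exists c : _ -> R, v = \sum_t c t *: G t)) => [|v w [c ->] [d ->]|[x m] _ /=].
- by exists (fun=> 0); rewrite big1 // => t _; rewrite scale0r.
- by exists (fun t => c t + d t); rewrite -big_split; apply: eq_bigr => t _; rewrite scalerDl.
have p0l n : pure_tensor (0 : X) n = 0 :> tensor X M.
  by apply: (addIr (pure_tensor (0 : X) n)); rewrite -pDl !add0r.
have p0r y : pure_tensor y (0 : M) = 0 :> tensor X M.
  by apply: (addIr (pure_tensor y (0 : M))); rewrite -pDr !add0r.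
have [c ->] := hh m.
have [d hd] : exists d : 'I_q -> 'I_p -> R,
    forall j, ract x (c j) = \sum_i d j i *: g i.
  exists (fun j => projT1 (cid (hg (ract x (c j))))) => j.
  by case: (cid _).
exists (fun t => d t.2 t.1).
rewrite -(pair_bigA _ (fun i j => d j i *: G (i, j))) /= exchange_big /=.
rewrite (big_morph (fun m => pure_tensor x m) (pDr x) (p0r x)).
apply: eq_bigr => j _; rewrite -pA hd.
rewrite (big_morph (fun y => pure_tensor y (h j)) (fun y z => pDl y z (h j)) (p0l (h j))).
by apply: eq_bigr => i _; rewrite -pure_scale.
Qed.

Section Complexes.
Variable R : pzRingType.

(* Bounded above cochain complexes of finitely generated modules. *)
Record complex := Complex {
  term : int -> lmodType R;
  diff : forall n, {linear term n -> term (n + 1)};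
  diff_diff : forall n x, diff (n + 1) (diff n x) = 0;
  term_fg : forall n, finitely_generated (term n);
  bounded_above : exists N, forall n, N <= n -> forall x : term n, x = 0 }.

Record chain_map (C D : complex) := ChainMap {
  chain :> forall n, {linear term C n -> term D n};
  chain_diff : forall n x, chain (n + 1) (diff C n x) = diff D n (chain n x) }.

Definition chain_eq (C D : complex) (f g : chain_map C D) : Prop :=
  forall n x, f n x = g n x.

Definition chain_id (C : complex) : chain_map C C :=
  @ChainMap C C (fun n => idfun) (fun n x => erefl).

Lemma chain_comp_diff (C D E : complex) (f : chain_map D E) (g : chain_map C D) n x :
  (f (n + 1) \o g (n + 1)) (diff C n x) = diff E n ((f n \o g n) x).
Proof. by rewrite /= !chain_diff. Qed.

Definition chain_comp (C D E : complex) (f : chain_map D E) (g : chain_map C D) :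
    chain_map C E :=
  @ChainMap C E (fun n => f n \o g n) (chain_comp_diff f g).

Definition complexes : category.
Proof.
refine (@Category complex chain_map chain_eq chain_id chain_comp _ _ _ _ _ _ _).
- by [].
- by move=> X Y f g e n x; rewrite e.
- by move=> X Y f g h e1 e2 n x; rewrite e1 e2.
- by move=> X Y Z f f' g g' e1 e2 n x /=; rewrite e2 e1.
- by [].
- by [].
- by [].
Defined.

(* Injectivity and surjectivity of the induced map in cohomology, in degree
   n + 1, for all n : int. *)
Definition quasi_iso (C D : complexes) (f : hom C D) : Prop :=
  forall n,
    (forall x : term C (n + 1), diff C (n + 1) x = 0 ->
       (exists y, f (n + 1) x = diff D n y) -> exists z, x = diff C n z) /\
    (forall y : term D (n + 1), diff D (n + 1) y = 0 ->
       exists x z, diff C (n + 1) x = 0 /\ y = f (n + 1) x + diff D n z).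

(* D^-(mod R). *)
Definition derived_category : category := localization quasi_iso.

Definition projective (P : lmodType R) : Prop :=
  forall (M N : lmodType R) (p : {linear M -> N}) (f : {linear P -> N}),
    (forall y, exists x, p x = y) -> exists g : {linear P -> M}, forall x, p (g x) = f x.

(* Isomorphic in D^-(mod R) to a bounded complex of finitely generated projective
   modules; boundedness above is part of the notion of complex. *)
Definition perfect (C : derived_category) : Prop :=
  exists P : derived_category,
    [/\ forall n, projective (term P n),
        exists N, forall n, n <= N -> forall x : term P n, x = 0 &
        isomorphic C P].
Definition perf : category := full_subcategory perfect.

Section TensorFunctor.
Variables (X : bimodule R) (X_fg : finitely_generated X).

Lemma tensor_map_id (M : lmodType R) (u : tensor X M) : tensor_map X idfun u = u.
Proof.
have [s ->] := formal_surj u; rewrite tensor_map_formal; congr formal.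
by rewrite -[RHS]map_id; apply: eq_map => -[].
Qed.

Lemma tensor_map_comp (M N P : lmodType R) (g : {linear N -> P}) (f : {linear M -> N}) u :
  tensor_map X (g \o f) u = tensor_map X g (tensor_map X f u).
Proof.
by have [s ->] := formal_surj u; rewrite !tensor_map_formal -map_comp.
Qed.

Lemma tensor_map_ext (M N : lmodType R) (f g : {linear M -> N}) u :
  (forall x, f x = g x) -> tensor_map X f u = tensor_map X g u.
Proof.
move=> e; have [s ->] := formal_surj u; rewrite !tensor_map_formal.
by congr formal; apply: eq_map => t; rewrite e.
Qed.

Lemma tensor_map0 (M N : lmodType R) (f : {linear M -> N}) u :
  (forall x, f x = 0) -> tensor_map X f u = 0.
Proof.
move=> e; rewrite (_ : u = u + (0 : R) *: u) ?scale0r ?addr0 //.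
have [s ->] := formal_surj u; rewrite tensor_map_formal formal_sum big_map.
rewrite big1 // => t _ /=; rewrite e.
have [_ h _] := pure_balanced X N.
by apply: (addIr (pure_tensor t.1 0)); rewrite -h !add0r.
Qed.

Lemma tensor0 (M : lmodType R) (u : tensor X M) : (forall x : M, x = 0) -> u = 0.
Proof. by move=> e; rewrite -[LHS]tensor_map_id tensor_map0. Qed.

Section TensorComplex.
Variable C : complex.
Definition tensor_diff n : {linear tensor X (term C n) -> tensor X (term C (n + 1))} :=
  tensor_map X (diff C n).

Lemma tensor_diff_diff n u : tensor_diff (n + 1) (tensor_diff n u) = 0.
Proof.
rewrite /tensor_diff /= -tensor_map_comp; apply: tensor_map0.
exact: diff_diff.
Qed.

Lemma tensor_bounded : exists N, forall n, N <= n -> forall x : tensor X (term C n), x = 0.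
Proof.
by have [N h] := bounded_above C; exists N => n /h e x; apply: tensor0.
Qed.

Definition tensor_complex : complexes :=
  @Complex (fun n => tensor X (term C n)) tensor_diff tensor_diff_diff
    (fun n => tensor_fg X_fg (term_fg C n)) tensor_bounded.
End TensorComplex.

Section TensorChain.
Variables (C D : complexes) (f : hom C D).
Definition tensor_chain_map n : {linear tensor X (term C n) -> tensor X (term D n)} :=
  tensor_map X (f n).

Lemma tensor_chain_diff n u :
  tensor_chain_map (n + 1) (tensor_diff C n u) = tensor_diff D n (tensor_chain_map n u).
Proof.
rewrite /tensor_chain_map /tensor_diff /= -!tensor_map_comp.
by apply: tensor_map_ext => x; apply: chain_diff.
Qed.

Definition tensor_chain : hom (tensor_complex C) (tensor_complex D) :=
  @ChainMap (tensor_complex C) (tensor_complex D) tensor_chain_map tensor_chain_diff.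
End TensorChain.

Definition tensor_functor : functor complexes complexes.
Proof.
refine (@Functor complexes complexes tensor_complex tensor_chain _ _ _).
- by move=> C D f g e n u; apply: tensor_map_ext; apply: e.
- by move=> C n u; apply: tensor_map_id.
- by move=> C D E f g n u; apply: tensor_map_comp.
Defined.
End TensorFunctor.
End Complexes.

Section Twist.
Variables (k : fieldType) (A : kalgebra k).

Record involution := Involution {
  invol :> {rmorphism A -> A};
  invol_alg : forall c, invol (alg_map A c) = alg_map A c;
  involK : involutive invol }.

Variable eps : involution.

(* A_eps: the regular left module with right action x * eps a. *)
Definition twisted_ract (x : A^o) (a : A) : A^o := (x : A) * eps a.

Definition twisted_bimodule : bimodule A.
Proof.
refine (@Bimodule A A^o twisted_ract _ _ _ _ _); rewrite /twisted_ract.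
- by move=> x y a; apply: mulrDl.
- by move=> x a b; rewrite rmorphD; apply: mulrDr.
- by move=> x; rewrite rmorph1 mulr1.
- by move=> x a b; rewrite rmorphM mulrA.
- by move=> a x b; apply: (esym (mulrA (a : A) (x : A) (eps b))).
Defined.

Lemma twisted_fg : finitely_generated twisted_bimodule.
Proof.
exists 1%N, (fun _ => (1 : A^o)) => x; exists (fun _ => x).
by rewrite big_ord1; rewrite -[RHS]/((x : A) * 1) mulr1.
Qed.

Definition twist_complexes : functor (complexes A) (complexes A) :=
  tensor_functor twisted_fg.

(* The map m |-> 1 (x) m from M to A_eps (x) M is bijective, so that tensoring
   with A_eps preserves quasi-isomorphisms. *)
Section UnitTensor.
Variable M : lmodType A.

Definition unit_tensor (m : M) : tensor twisted_bimodule M :=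
  pure_tensor (1 : twisted_bimodule) m.

Lemma unit_tensor_pure (a : A) m :
  pure_tensor (a : twisted_bimodule) m = unit_tensor (eps a *: m).
Proof.
have [_ _ pA] := pure_balanced twisted_bimodule M.
rewrite /unit_tensor -pA; congr pure_tensor.
by apply: esym; rewrite -[LHS]/(1 * eps (eps a)) mul1r involK.
Qed.

Lemma unit_tensorD : {morph unit_tensor : m n / m + n}.
Proof. by have [_ pD _] := pure_balanced twisted_bimodule M => m n; apply: pD. Qed.

Lemma unit_tensor0 : unit_tensor 0 = 0.
Proof. by apply: (addIr (unit_tensor 0)); rewrite -unit_tensorD !add0r. Qed.

Lemma unit_tensor_surj u : exists m, u = unit_tensor m.
Proof.
have [s ->] := formal_surj u; rewrite formal_sum.
apply: (big_ind (fun v => exists m, v = unit_tensor m)) => [|v w [m ->] [n ->]|t _].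
- by exists 0; rewrite unit_tensor0.
- by exists (m + n); rewrite unit_tensorD.
- by exists (eps t.1 *: t.2); rewrite -unit_tensor_pure.
Qed.

Lemma unit_tensor_inj : injective unit_tensor.
Proof.
pose f (a : twisted_bimodule) (m : M) : M := eps (a : A) *: m.
have fb : balanced f.
  split=> [x y m|x m n|x a m]; rewrite /f.
  - by rewrite raddfD scalerDl.
  - by rewrite scalerDr.
  - by rewrite -[ract x a]/((x : A) * eps a) rmorphM involK scalerA.
have fK m : tensor_lift f (unit_tensor m) = m.
  by rewrite tensor_liftE // /formal_eval big_seq1 /f rmorph1 scale1r.
exact: can_inj fK.
Qed.
End UnitTensor.

Lemma unit_tensor_map (M N : lmodType A) (h : {linear M -> N}) m :
  tensor_map twisted_bimodule h (unit_tensor m) = unit_tensor (h m).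
Proof. exact: tensor_map_formal. Qed.

Lemma twist_quasi_iso (C D : complexes A) (s : hom C D) :
  quasi_iso s -> quasi_iso (fhom twist_complexes s).
Proof.
move=> qs n; have [inj surj] := qs n; split=> /= u.
  have [x ->] := unit_tensor_surj u.
  rewrite unit_tensor_map -unit_tensor0 => /unit_tensor_inj dx [v].
  have [y ->] := unit_tensor_surj v.
  rewrite !unit_tensor_map => /unit_tensor_inj e.
  have [z ->] := inj x dx (ex_intro _ y e).
  by exists (unit_tensor z); rewrite unit_tensor_map.
have [y ->] := unit_tensor_surj u.
rewrite unit_tensor_map -unit_tensor0 => /unit_tensor_inj /surj [x [z [dx ->]]].
exists (unit_tensor x), (unit_tensor z).
by rewrite !unit_tensor_map dx unit_tensorD unit_tensor0.
Qed.

(* The functor A_eps (x)_A - on D^-(mod A); A_eps is flat, so that no resolution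
   is needed. *)
Definition twist : functor (derived_category A) (derived_category A) :=
  induced_functor twist_quasi_iso.
End Twist.

Section Dual.
Variables (k : fieldType) (A : kalgebra k).

(* The k-dual of A, with (a . f) x = f (x * a) and (f . a) x = f (a * x). *)
Record dual := Dual {
  dual_fun :> A -> k;
  dualD : forall x y, dual_fun (x + y) = dual_fun x + dual_fun y;
  dualZ : forall c x, dual_fun (alg_map A c * x) = c * dual_fun x }.
HB.instance Definition _ := gen_eqMixin dual.
HB.instance Definition _ := gen_choiceMixin dual.

Lemma dual_ext (f g : dual) : f =1 g -> f = g.
Proof.
case: f g => [f fD fZ] [g gD gZ] /= h.
have e : f = g by apply: funext.
by subst g; congr Dual; apply: Prop_irrelevance.
Qed.

Definition dual_zero : dual.
Proof. by refine (@Dual (fun=> 0) _ _) => *; rewrite ?addr0 ?mulr0. Defined.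
Definition dual_opp (f : dual) : dual.
Proof.
refine (@Dual (fun x => - f x) _ _) => [x y|c x].
- by rewrite dualD opprD.
- by rewrite dualZ mulrN.
Defined.
Definition dual_add (f g : dual) : dual.
Proof.
refine (@Dual (fun x => f x + g x) _ _) => [x y|c x].
- by rewrite !dualD addrACA.
- by rewrite !dualZ mulrDr.
Defined.
Definition dual_lact (a : A) (f : dual) : dual.
Proof.
refine (@Dual (fun x => f (x * a)) _ _) => [x y|c x].
- by rewrite mulrDl dualD.
- by rewrite -mulrA dualZ.
Defined.
Definition dual_ract (f : dual) (a : A) : dual.
Proof.
refine (@Dual (fun x => f (a * x)) _ _) => [x y|c x].
- by rewrite mulrDr dualD.
- by rewrite mulrA -alg_central -mulrA dualZ.
Defined.

Let addA : associative dual_add.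
Proof. by move=> f g h; apply: dual_ext => x /=; rewrite addrA. Qed.
Let addC : commutative dual_add.
Proof. by move=> f g; apply: dual_ext => x /=; rewrite addrC. Qed.
Let add0 : left_id dual_zero dual_add.
Proof. by move=> f; apply: dual_ext => x /=; rewrite add0r. Qed.
Let addN : left_inverse dual_zero dual_opp dual_add.
Proof. by move=> f; apply: dual_ext => x /=; rewrite addNr. Qed.
HB.instance Definition _ := GRing.isZmodule.Build dual addA addC add0 addN.

Let lactA a b f : dual_lact a (dual_lact b f) = dual_lact (a * b) f.
Proof. by apply: dual_ext => x /=; rewrite mulrA. Qed.
Let lact1 : left_id 1 dual_lact.
Proof. by move=> f; apply: dual_ext => x /=; rewrite mulr1. Qed.
Let lactDr : right_distributive dual_lact +%R.
Proof. by move=> a f g; apply: dual_ext. Qed.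
Let lactDl f : {morph dual_lact^~ f : a b / a + b}.
Proof. by move=> a b; apply: dual_ext => x /=; rewrite mulrDr dualD. Qed.
HB.instance Definition _ :=
  GRing.Zmodule_isLmodule.Build A dual lactA lact1 lactDr lactDl.

Definition dual_bimodule : bimodule A.
Proof.
refine (@Bimodule A dual dual_ract _ _ _ _ _).
- by move=> f g a; apply: dual_ext.
- by move=> f a b; apply: dual_ext => x /=; rewrite mulrDl dualD.
- by move=> f; apply: dual_ext => x /=; rewrite mul1r.
- by move=> f a b; apply: dual_ext => x /=; rewrite mulrA.
- by move=> a f b; apply: dual_ext => x /=; rewrite mulrA.
Defined.
End Dual.

Lemma dual_fg (k : fieldType) (A : kalgebra k) :
  finite_dimensional A -> finitely_generated (dual_bimodule A).
Proof.
move=> [n [g hg]].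
pose ev (f : dual A) : 'rV[k]_n := \row_j f (g j).
have f0 (f : dual A) : f 0 = 0 by rewrite -[0 in LHS](mul0r 0) -(rmorph0 (alg_map A)) dualZ mul0r.
have fE (f : dual A) (c : 'I_n -> k) :
    f (\sum_i alg_map A (c i) * g i) = \sum_i c i * f (g i).
  rewrite (big_morph f (dualD f) (f0 f)); apply: eq_bigr => i _; exact: dualZ.
pose mx p (F : 'I_p -> dual A) : 'M[k]_(p, n) := \matrix_i ev (F i).
pose P r := `[< exists p (F : 'I_p -> dual A), \rank (mx p F) = r >].
have exP : exists r, P r.
  by exists (\rank (mx 0%N (fun=> dual_zero A))); apply/asboolP; exists 0%N, (fun=> dual_zero A).
have ubP r : P r -> (r <= n)%N by move=> /asboolP[p [F <-]]; apply: rank_leq_col.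
case: (ex_maxnP exP ubP) => r /asboolP[p [F rF]] maxr.
exists p, F => f.
have sub : (ev f <= mx p F)%MS.
  pose F' (i : 'I_(p + 1)) := match split i with inl j => F j | inr _ => f end.
  have e : mx (p + 1)%N F' = col_mx (mx p F) (ev f).
    apply/matrixP => i j; rewrite !mxE /F'.
    by case: (split i) => l; rewrite ?mxE // (ord1 l) !mxE.
  have := maxr (\rank (mx (p + 1)%N F')).
  rewrite e -addsmxE => h.
  have le : (\rank (mx p F + ev f)%MS <= \rank (mx p F))%N.
    by rewrite rF; apply: h; apply/asboolP; exists (p + 1)%N, F'; rewrite e addsmxE.
  have /eqmxP eq : (mx p F == mx p F + ev f)%MS.
    by rewrite -(geq_leqif (mxrank_leqif_eq (addsmxSl _ _))).
  by rewrite eq addsmxSr.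
have [c hc] := submxP sub.
exists (fun i => alg_map A (c 0 i)); apply: dual_ext => x; have [d ->] := hg x.
have sumE m (G : 'I_m -> dual A) (y : A) : (\sum_i G i : dual A) y = \sum_i G i y.
  by elim/big_rec2: _ => // i a b _ <-.
rewrite sumE fE.
have fgE j : f (g j) = \sum_i c 0 i * F i (g j).
  have /rowP/(_ j) := hc; rewrite !mxE => ->; apply: eq_bigr => i _; by rewrite !mxE.
transitivity (\sum_i c 0 i * F i (\sum_j alg_map A (d j) * g j)).
  under [RHS]eq_bigr do rewrite fE mulr_sumr.
  rewrite exchange_big; apply: eq_bigr => j _ /=.
  by rewrite fgE mulr_sumr; apply: eq_bigr => i _; rewrite mulrCA.
by apply: eq_bigr => i _ /=; rewrite -alg_central dualZ.
Qed.

(* A^* (x)^L_A - on D^-(mod A), together with its defining counit. *)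
Definition derived_nakayama (k : fieldType) (A : kalgebra k)
    (A_fd : finite_dimensional A) : Type :=
  left_derived (@quasi_iso A) (tensor_functor (dual_fg A_fd)).

(* Main.v *)
(* A is spanned by the paths along sigma.  Let e a be the length of the maximal
   cycle c_a^{m(v_a)}.  If a and b are the two arrows starting at a vertex, then
   c_a^{m(v_a)} = - c_b^{m(v_b)} in A.  Choose signs s with s a = - s b; then the
   linear form phi with value s a on c_a^{m(v_a)} and 0 on all other paths is well
   defined.  Explicit dual families show that x |-> phi (- * x) is a bijection
   from A onto A^*, and phi (x * y) = phi (y * x') holds with x' = s a * s c * x for
   a path x along sigma that starts with a and is followed by c.  Thus the Nakayama
   automorphism of phi is an involution and A^* is isomorphic to A_eps as a bimodule.
   As A_eps (x) - is exact, it is its own left derived functor. *)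

From HB Require Import structures.
From mathcomp Require Import all_boot all_order all_algebra perm.
From mathcomp Require Import finmap boolp.
From mathcomp Require Import xfinmap monalg.
From mathcomp Require Import zify.
Require Import Defs.
Set Implicit Arguments. Unset Strict Implicit. Unset Printing Implicit Defensive.
Import Order.TTheory GRing.Theory Num.Theory.
Local Open Scope ring_scope.

(** * Functors and localization *)

(** [A] is a quotient of a completion, so no basis of it is at hand. Linear independence of paths is
    replaced by one identity, x = sum over t of phi (h_t x) g_t: it is linear in x, can be checked
    on a spanning set of paths, and yields injectivity and surjectivity of A -> A^* together. The
    form is defined on kQ, where the paths are a basis, and then descends through I, a power of the
    arrow ideal and z; it survives the last step because the two signs at a vertex add up to zero.
    The completion is controlled by the fact that elements deep in the arrow filtration are
    multiples of z, so that kQ maps onto [A] and every check takes place on paths. The Nakayama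
    automorphism is chosen elementwise as the solution of an equation that phi makes unique, and its
    multiplicativity is then formal. A derived functor is known only through its universal property;
    any [nu] is therefore compared with the twist by uniqueness. *)

Section Isomorphisms.
Variable C : category.

Lemma isomorphism_comp (X Y Z : C) (f : hom Y Z) (g : hom X Y) :
  isomorphism f -> isomorphism g -> isomorphism (compose f g).
Proof.
move=> [f' [lf rf]] [g' [lg rg]]; exists (compose g' f'); split.
- apply: heq_trans (heq_sym (compA _ _ _)) _; apply: heq_trans _ lg.
  apply: compose_heq (heq_refl _) _.
  apply: heq_trans (compA _ _ _) _; apply: heq_trans _ (comp1m _).
  exact: compose_heq lf (heq_refl _).
- apply: heq_trans (heq_sym (compA _ _ _)) _; apply: heq_trans _ rf.
  apply: compose_heq (heq_refl _) _.
  apply: heq_trans (compA _ _ _) _; apply: heq_trans _ (comp1m _).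
  exact: compose_heq rg (heq_refl _).
Qed.

Lemma isomorphic_trans (X Y Z : C) :
  isomorphic X Y -> isomorphic Y Z -> isomorphic X Z.
Proof. by move=> [f If] [g Ig]; exists (compose g f); apply: isomorphism_comp. Qed.

Lemma isomorphic_sym (X Y : C) : isomorphic X Y -> isomorphic Y X.
Proof. by move=> [f [g [l r]]]; exists g, f. Qed.

Lemma isomorphism_fhom (D : category) (F : functor C D) (X Y : C) (f : hom X Y) :
  isomorphism f -> isomorphism (fhom F f).
Proof.
move=> [g [l r]]; exists (fhom F g); split;
  apply: heq_trans (heq_sym (fhom_comp _ _ _)) _; apply: heq_trans _ (fhom1 _ _);
  exact: fhom_heq.
Qed.

Lemma isomorphism_cancel (X Y Z : C) (f : hom Y Z) (g h : hom X Y) :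
  isomorphism f -> heq (compose f g) (compose f h) -> heq g h.
Proof.
move=> [f' [l _]] e.
have aux (u : hom X Y) : heq u (compose f' (compose f u)).
  apply: heq_trans _ (heq_sym (compA _ _ _)); apply: heq_trans (heq_sym (comp1m _)) _.
  exact: compose_heq (heq_sym l) (heq_refl _).
apply: heq_trans (aux g) _; apply: heq_trans _ (heq_sym (aux h)).
exact: compose_heq (heq_refl _) e.
Qed.
End Isomorphisms.

Section FunctorIso.
Variables (C D : category).

Lemma functor_iso_sym (F G : functor C D) : functor_iso F G -> functor_iso G F.
Proof.
move=> [t It]; pose u X := projT1 (cid (It X)).
have uE X : heq (compose (u X) (t X)) (idm (F X)) /\ heq (compose (t X) (u X)) (idm (G X)).
  by rewrite /u; case: (cid _).
have un X Y (f : hom X Y) :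
    heq (compose (u Y) (fhom G f)) (compose (fhom F f) (u X)).
  apply: (@isomorphism_cancel D _ _ _ (t Y)); first by exists (u Y); apply: uE.
  apply: heq_trans (compA _ _ _) _.
  apply: heq_trans (compose_heq (uE Y).2 (heq_refl _)) _.
  apply: heq_trans (comp1m _) _.
  apply: heq_trans _ (heq_sym (compA _ _ _)).
  apply: heq_trans _ (compose_heq (heq_sym (ntrans_nat t f)) (heq_refl _)).
  apply: heq_trans _ (compA _ _ _).
  apply: heq_trans (heq_sym (compm1 _)) _.
  exact: compose_heq (heq_refl _) (heq_sym (uE X).2).
exists (NatTrans un) => X; exists (t X); split; [exact: (uE X).2|exact: (uE X).1].
Qed.

Lemma ntrans_comp_nat (F G H : functor C D) (t : nat_trans G H) (u : nat_trans F G)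
    X Y (f : hom X Y) :
  heq (compose (compose (t Y) (u Y)) (fhom F f)) (compose (fhom H f) (compose (t X) (u X))).
Proof.
apply: heq_trans (heq_sym (compA _ _ _)) _.
apply: heq_trans (compose_heq (heq_refl _) (ntrans_nat u f)) _.
apply: heq_trans (compA _ _ _) _.
apply: heq_trans (compose_heq (ntrans_nat t f) (heq_refl _)) _.
exact: heq_sym (compA _ _ _).
Qed.

Definition ntrans_comp (F G H : functor C D) (t : nat_trans G H) (u : nat_trans F G) :
  nat_trans F H := NatTrans (ntrans_comp_nat t u).

Lemma functor_iso_trans (F G H : functor C D) :
  functor_iso F G -> functor_iso G H -> functor_iso F H.
Proof.
move=> [t It] [u Iu]; exists (ntrans_comp u t) => X.
exact: isomorphism_comp (Iu X) (It X).
Qed.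
End FunctorIso.

Lemma functor_iso_sqr (C : category) (F G : functor C C) :
  functor_iso F G -> functor_iso (comp_functor F F) (comp_functor G G).
Proof.
move=> [t It].
have tn X Y (f : hom X Y) :
    heq (compose (compose (t (G Y)) (fhom F (t Y))) (fhom F (fhom F f)))
        (compose (fhom G (fhom G f)) (compose (t (G X)) (fhom F (t X)))).
  apply: heq_trans (heq_sym (compA _ _ _)) _.
  apply: heq_trans _ (heq_sym (compA _ _ _)).
  apply: heq_trans _ (compose_heq (ntrans_nat t (fhom G f)) (heq_refl _)).
  apply: heq_trans _ (compA _ _ _); apply: compose_heq (heq_refl _) _.
  apply: heq_trans (heq_sym (fhom_comp F _ _)) _.
  apply: heq_trans _ (fhom_comp F _ _).
  exact: fhom_heq (ntrans_nat t f).
exists (@NatTrans _ _ (comp_functor F F) (comp_functor G G) _ tn) => X.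
exact: isomorphism_comp (It (G X)) (isomorphism_fhom F (It X)).
Qed.

Section Restriction.
Variables (C : category) (P : C -> Prop).

Lemma functor_iso_restrict (F G : functor C C) (PF : preserves P F) (PG : preserves P G) :
  functor_iso F G -> functor_iso (restrict PF) (restrict PG).
Proof.
move=> [t It].
pose t' (X : full_subcategory P) : hom (restrict PF X) (restrict PG X) := t (sval X).
have tn X Y (f : hom X Y) :
    heq (compose (t' Y) (fhom (restrict PF) f)) (compose (fhom (restrict PG) f) (t' X)).
  exact: (@ntrans_nat _ _ _ _ t (sval X) (sval Y) f).
exists (NatTrans tn) => X.
by have [g [l r]] := It (sval X); exists g.
Qed.

Lemma functor_iso_restrict_sqr (F : functor C C) (PF : preserves P F) :
  functor_iso (comp_functor F F) (id_functor C) ->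
  functor_iso (comp_functor (restrict PF) (restrict PF)) (id_functor (full_subcategory P)).
Proof.
move=> [t It]; pose F' := comp_functor (restrict PF) (restrict PF).
pose t' (X : full_subcategory P) : hom (F' X) X := t (sval X).
have tn X Y (f : hom X Y) : heq (compose (t' Y) (fhom F' f)) (compose f (t' X)).
  exact: (@ntrans_nat _ _ _ _ t (sval X) (sval Y) f).
exists (@NatTrans _ _ F' (id_functor _) t' tn) => X.
by have [g [l r]] := It (sval X); exists g.
Qed.

Lemma preserves_iso (F G : functor C C) :
  (forall X Y, isomorphic X Y -> P X -> P Y) ->
  functor_iso F G -> preserves P F -> preserves P G.
Proof. by move=> h [t It] PF X PX; apply: h (PF X PX); exists (t X). Qed.
End Restriction.

(** * Functors on a localization and left derived functors *)

Section LocalizationFunctors.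
Variables (C : category) (W : forall X Y : C, hom X Y -> Prop).
Local Notation L := (localization W).
Local Notation fwd f := (loc_fwd W f : @hom (localization W) _ _).

(** Induction on formal composites. At the formal inverse of s, naturality follows from naturality
    at s, because [H] sends s to an isomorphism that can be cancelled. *)
Lemma loc_natural (G H : functor L L) (t : forall X : L, hom (G X) (H X)) :
  (forall (X Y : C) (f : hom X Y),
     heq (compose (t Y) (fhom G (fwd f)))
         (compose (fhom H (fwd f)) (t X))) ->
  forall (X Y : L) (f : hom X Y),
    heq (compose (t Y) (fhom G f)) (compose (fhom H f) (t X)).
Proof.
move=> tn X Y; elim=> {X Y} [X Y f|X Y s Ws|X Y Z f IHf g IHg]; first exact: tn.
- have is_iso : isomorphism (fwd s).
    by exists (loc_inv Ws); split; [exact: loc_invl|exact: loc_invr].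
  apply: (isomorphism_cancel (isomorphism_fhom H is_iso)).
  apply: heq_trans (compA _ _ _) _.
  apply: heq_trans (compose_heq (heq_sym (tn _ _ s)) (heq_refl _)) _.
  apply: heq_trans (heq_sym (compA _ _ _)) _.
  apply: heq_trans _ (heq_sym (compA _ _ _)).
  apply: (@heq_trans _ _ _ _ (t Y)).
    apply: heq_trans _ (compm1 _); apply: compose_heq (heq_refl _) _.
    apply: heq_trans (heq_sym (fhom_comp G _ _)) _; apply: heq_trans _ (fhom1 G _).
    apply: fhom_heq; exact: loc_invr.
  apply: heq_trans (heq_sym (comp1m _)) _; apply: compose_heq _ (heq_refl _).
  apply: heq_sym; apply: heq_trans (heq_sym (fhom_comp H _ _)) _.
  apply: heq_trans _ (fhom1 H _); apply: fhom_heq; exact: loc_invr.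
- apply: heq_trans (compose_heq (heq_refl _) (fhom_comp G (f : @hom L Y Z) (g : @hom L X Y))) _.
  apply: heq_trans _
    (compose_heq (heq_sym (fhom_comp H (f : @hom L Y Z) (g : @hom L X Y))) (heq_refl _)).
  apply: heq_trans (compA _ _ _) _.
  apply: heq_trans (compose_heq IHf (heq_refl _)) _.
  apply: heq_trans (heq_sym (compA _ _ _)) _.
  apply: heq_trans (compose_heq (heq_refl _) IHg) _.
  exact: compA.
Qed.

Lemma isomorphism_loc_fwd (X Y : C) (f : hom X Y) :
  isomorphism f -> isomorphism (fwd f).
Proof. exact: (isomorphism_fhom (loc_functor W)). Qed.

Lemma induced_functor_sqr (F : functor C C)
    (FW : forall X Y (s : hom X Y), W s -> W (fhom F s)) :
  functor_iso (comp_functor F F) (id_functor C) ->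
  functor_iso (comp_functor (induced_functor FW) (induced_functor FW)) (id_functor L).
Proof.
move=> [t It]; pose F' := comp_functor (induced_functor FW) (induced_functor FW).
have tn : forall (X Y : L) (f : hom X Y),
    heq (compose (fwd (t Y)) (fhom F' f)) (compose f (fwd (t X))).
  apply: (@loc_natural F' (id_functor L)) => X Y f.
  apply: loc_trans (loc_sym (loc_fwd_comp _ _ _)) _.
  apply: loc_trans _ (loc_fwd_comp _ _ _).
  apply: loc_fwd_heq; exact: (ntrans_nat t f).
exists (@NatTrans _ _ F' (id_functor L) _ tn) => X.
exact: isomorphism_loc_fwd (It X).
Qed.

(** A functor that preserves [W] descends to the localization, and the isomorphism with [F'] makes
    the counit c invertible. A lift of r is then forced to be the inverse of c composed with r. *)
Lemma induced_left_derived (F F' : functor C C)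
    (FW : forall X Y (s : hom X Y), W s -> W (fhom F s)) :
  functor_iso F F' ->
  exists D : left_derived W F', derived_functor D = induced_functor FW.
Proof.
move=> [t It].
have cn X Y (f : hom X Y) :
    heq (compose (fwd (t Y))
                 (fhom (comp_functor (induced_functor FW) (loc_functor W)) f))
        (compose (fhom (comp_functor (loc_functor W) F') f) (fwd (t X))).
  apply: loc_trans (loc_sym (loc_fwd_comp _ _ _)) _.
  apply: loc_trans _ (loc_fwd_comp _ _ _).
  apply: loc_fwd_heq; exact: (ntrans_nat t f).
pose c := @NatTrans _ _ (comp_functor (induced_functor FW) (loc_functor W))
                   (comp_functor (loc_functor W) F') (fun X => fwd (t X)) cn.
have Ic X : isomorphism (c X) := isomorphism_loc_fwd (It X).
suff univ (G : functor L L)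
    (r : nat_trans (comp_functor G (loc_functor W)) (comp_functor (loc_functor W) F')) :
    let lifts (u : nat_trans G (induced_functor FW)) :=
      forall X : C, heq (compose (c X) (u X)) (r X) in
    exists u, lifts u /\ forall v, lifts v -> forall X, heq (u X) (v X).
  by exists (LeftDerived univ).
move=> lifts.
pose c' X := projT1 (cid (Ic X)).
have c'E X : heq (compose (c' X) (c X)) (idm _) /\ heq (compose (c X) (c' X)) (idm _).
  by rewrite /c'; case: (cid _).
have cK (X : C) (Z : L) (h : hom Z (loc_functor W (F' X))) :
    heq (compose (c X) (compose (c' X) h)) h.
  apply: heq_trans (compA _ _ _) _; apply: heq_trans _ (comp1m _).
  exact: compose_heq (c'E X).2 (heq_refl _).
have un : forall (X Y : L) (f : hom X Y),
    heq (compose (compose (c' Y) (r Y)) (fhom G f))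
        (compose (fhom (induced_functor FW) f) (compose (c' X) (r X))).
  apply: (@loc_natural G (induced_functor FW) (fun X => compose (c' X) (r X))) => X Y f.
  apply: (isomorphism_cancel (Ic Y)).
  apply: heq_trans (compose_heq (heq_refl _) (heq_sym (compA _ _ _))) _.
  apply: heq_trans (cK _ _ _) _.
  apply: heq_trans (ntrans_nat r f) _.
  apply: heq_trans _ (heq_sym (compA _ _ _)).
  apply: heq_trans _ (compose_heq (heq_sym (ntrans_nat c f)) (heq_refl _)).
  apply: heq_trans _ (compA _ _ _); apply: compose_heq (heq_refl _) _.
  exact: heq_sym (cK _ _ _).
exists (NatTrans un); split=> [X|v hv X]; first exact: cK.
by apply: (isomorphism_cancel (Ic X)); apply: heq_trans (cK _ _ _) (heq_sym (hv X)).
Qed.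

(** Uniqueness of a terminal object: each composite of the two comparison maps lifts the counit
    through itself, and so does the identity. *)
Lemma left_derived_unique (F : functor C C) (D E : left_derived W F) : functor_iso D E.
Proof.
have comp_lift (G H K : left_derived W F) (u : nat_trans H K) (v : nat_trans G H) :
    (forall X, heq (compose (derived_counit K X) (u X)) (derived_counit H X)) ->
    (forall X, heq (compose (derived_counit H X) (v X)) (derived_counit G X)) ->
    forall X, heq (compose (derived_counit K X) (ntrans_comp u v X)) (derived_counit G X).
  move=> hu hv X; apply: heq_trans (compA _ _ _) _; apply: heq_trans _ (hv X).
  exact: compose_heq (hu X) (heq_refl _).
have id_nat (G : functor L L) X Y (f : hom X Y) :
    heq (compose (idm (G Y)) (fhom G f)) (compose (fhom G f) (idm (G X))).
  by apply: heq_trans (comp1m _) (heq_sym (compm1 _)).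
have auto (G : left_derived W F) (u : nat_trans G G) :
    (forall X, heq (compose (derived_counit G X) (u X)) (derived_counit G X)) ->
    forall X, heq (u X) (idm (G X)).
  move=> hu X; have [w [_ uw]] := @derived_univ _ _ _ G G (derived_counit G).
  apply: heq_trans (heq_sym (uw u hu X)) _.
  by apply: (uw (NatTrans (@id_nat G))) => Y; apply: compm1.
have [u [hu _]] := @derived_univ _ _ _ E D (derived_counit D).
have [v [hv _]] := @derived_univ _ _ _ D E (derived_counit E).
exists u => X; exists (v X); split.
- exact: (auto D (ntrans_comp v u) (comp_lift _ _ _ _ _ hv hu) X).
- exact: (auto E (ntrans_comp u v) (comp_lift _ _ _ _ _ hu hv) X).
Qed.
End LocalizationFunctors.

(** * Tensor functors and twists *)

(** The inverse is chosen pointwise; injectivity of [f] makes it linear and compatible with the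
    differentials. *)
Lemma isomorphism_chain (R : pzRingType) (C D : complexes R) (f : hom C D) :
  (forall n, injective (f n)) -> (forall n y, exists x, y = f n x) -> isomorphism f.
Proof.
move=> f_inj f_surj.
pose g n (y : term D n) : term C n := projT1 (cid (f_surj n y)).
have fK n y : f n (g n y) = y by rewrite /g; case: (cid _).
have g_lin n : linear (@g n).
  by move=> a x y; apply: (f_inj n); rewrite linearP !fK.
pose gl n : {linear term D n -> term C n} :=
  HB.pack (@g n) (GRing.isLinear.Build R (term D n) (term C n) _ (@g n) (g_lin n)).
have gd n x : gl (n + 1) (diff D n x) = diff C n (gl n x).
  by apply: (f_inj (n + 1)); rewrite /= fK chain_diff fK.
exists (@ChainMap R D C gl gd); split=> n x; last exact: fK.
by apply: (f_inj n); apply: fK.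
Qed.

Section BimoduleMap.
Variables (R : pzRingType) (X Y : bimodule R) (h : {linear X -> Y}).
Hypothesis h_ract : forall x a, h (ract x a) = ract (h x) a.
Variable M : lmodType R.

Definition tensor_bimap (u : tensor X M) : tensor Y M :=
  tensor_lift (fun x m => pure_tensor (h x) m) u.

Lemma tensor_bimap_formal s :
  tensor_bimap (formal s) = formal [seq (h t.1, t.2) | t <- s].
Proof.
have [pDl pDr pA] := pure_balanced Y M.
rewrite /tensor_bimap tensor_liftE ?(formal_sum, big_map) //.
split=> [x y m|x m n|x a m]; rewrite ?raddfD ?h_ract; [exact: pDl|exact: pDr|exact: pA].
Qed.

Lemma tensor_bimap_linear : linear tensor_bimap.
Proof.
move=> a u v; have [[s ->] [t ->]] := (formal_surj u, formal_surj v).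
rewrite formal_scale -formal_cat !tensor_bimap_formal formal_scale -formal_cat.
rewrite map_cat -!map_comp; congr (formal (_ ++ _)).
by apply: eq_map => p /=; rewrite linearZ.
Qed.
End BimoduleMap.

Section BimoduleIso.
Variables (R : pzRingType) (X Y : bimodule R) (h : {linear X -> Y}).
Hypothesis h_ract : forall x a, h (ract x a) = ract (h x) a.
Hypotheses (h_inj : injective h) (h_surj : forall y, exists x, y = h x).

Lemma tensor_bimap_surj M (v : tensor Y M) : exists u, v = tensor_bimap h u.
Proof.
have [s ->] := formal_surj v.
pose g (y : Y) : X := projT1 (cid (h_surj y)).
have hg y : h (g y) = y by rewrite /g; case: (cid _).
exists (formal [seq (g t.1, t.2) | t <- s]).
rewrite tensor_bimap_formal // -map_comp; congr formal.
by rewrite -[LHS]map_id; apply: eq_map => -[y m] /=; rewrite hg.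
Qed.

(** The pointwise inverse of [h] inherits additivity and compatibility with the right actions, so it
    induces a left inverse on tensors. *)
Lemma tensor_bimap_inj M : injective (@tensor_bimap R X Y h M).
Proof.
pose g (y : Y) : X := projT1 (cid (h_surj y)).
have hg y : h (g y) = y by rewrite /g; case: (cid _).
have gh x : g (h x) = x by apply: h_inj; rewrite hg.
have [pDl pDr pA] := pure_balanced X M.
have gb : balanced (fun y m => pure_tensor (g y) m : tensor X M).
  split=> [x y m|x m n|x a m].
  - by rewrite -pDl; congr (pure_tensor _ m); apply: h_inj; rewrite raddfD /= !hg.
  - by rewrite pDr.
  - by rewrite -pA; congr (pure_tensor _ m); apply: h_inj; rewrite h_ract !hg.
apply: (@can_inj _ _ _ (tensor_lift (fun y m => pure_tensor (g y) m))) => u.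
have [s ->] := formal_surj u; rewrite tensor_bimap_formal // tensor_liftE //.
by rewrite /formal_eval big_map formal_sum; apply: eq_bigr => t _ /=; rewrite gh.
Qed.

Lemma tensor_functor_iso (X_fg : finitely_generated X) (Y_fg : finitely_generated Y) :
  functor_iso (tensor_functor X_fg) (tensor_functor Y_fg).
Proof.
pose F := tensor_functor X_fg; pose G := tensor_functor Y_fg.
have b_lin M := tensor_bimap_linear h_ract M.
pose bl M : {linear tensor X M -> tensor Y M} :=
  HB.pack (@tensor_bimap R X Y h M)
    (GRing.isLinear.Build R (tensor X M) (tensor Y M) _ (@tensor_bimap R X Y h M) (@b_lin M)).
have blE M u : bl M u = tensor_bimap h u by [].
have bn (M N : lmodType R) (f : {linear M -> N}) u :
    bl N (tensor_map X f u) = tensor_map Y f (bl M u).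
  have [s ->] := formal_surj u.
  by rewrite tensor_map_formal !blE !tensor_bimap_formal // tensor_map_formal -!map_comp.
have bd (C : complexes R) n u :
    bl (term C (n + 1)) (diff (F C) n u) = diff (G C) n (bl (term C n) u).
  exact: bn.
pose t (C : complexes R) : hom (F C) (G C) :=
  @ChainMap R (F C) (G C) (fun n => bl (term C n)) (@bd C).
have tn (C D : complexes R) (f : hom C D) :
    heq (compose (t D) (fhom F f)) (compose (fhom G f) (t C)).
  by move=> n u; apply: bn.
exists (@NatTrans _ _ F G t tn) => C; apply: isomorphism_chain => n.
- exact: tensor_bimap_inj.
- exact: tensor_bimap_surj.
Qed.
End BimoduleIso.

(** * The square of the twist, and perfect complexes *)

Section TwistSquare.
Variables (k : fieldType) (A : kalgebra k) (eps : involution A).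
Local Notation T := (tensor (twisted_bimodule eps)).
Local Notation Tmap := (tensor_map (twisted_bimodule eps)).
Local Notation unit := (unit_tensor eps).

Definition twist_unit (M : lmodType A) (m : M) : T (T M) := unit (unit m).

(** A single unit m |-> 1 (x) m is only semilinear along [eps]. As [eps] squares to the identity,
    applying it twice gives a linear map, which identifies the double twist with the identity
    functor. *)
Lemma unit_tensorZ (M : lmodType A) (a : A) (m : M) :
  unit (eps a *: m) = a *: unit m.
Proof.
rewrite -unit_tensor_pure /unit_tensor pure_scale; congr pure_tensor.
exact: (esym (mulr1 (a : A))).
Qed.

Lemma twist_unit_linear M : linear (@twist_unit M).
Proof.
move=> a x y; rewrite /twist_unit !unit_tensorD; congr (_ + _).
by rewrite -[a in a *: x](involK eps) !unit_tensorZ.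
Qed.
HB.instance Definition _ M :=
  GRing.isLinear.Build A M (T (T M)) _ (@twist_unit M) (@twist_unit_linear M).

Lemma twist_unit_inj M : injective (@twist_unit M).
Proof. by move=> x y /unit_tensor_inj /unit_tensor_inj. Qed.

Lemma twist_unit_surj M u : exists m, u = @twist_unit M m.
Proof.
have [v ->] := unit_tensor_surj u; have [m ->] := unit_tensor_surj v.
by exists m.
Qed.

Lemma twist_unit_nat (M N : lmodType A) (f : {linear M -> N}) m :
  Tmap (Tmap f) (twist_unit m) = twist_unit (f m).
Proof. by rewrite /twist_unit unit_tensor_map; congr (unit _); apply: unit_tensor_map. Qed.

Lemma twist_complexes_sqr :
  functor_iso (comp_functor (twist_complexes eps) (twist_complexes eps))
    (id_functor (complexes A)).
Proof.
apply: functor_iso_sym; pose F := comp_functor (twist_complexes eps) (twist_complexes eps).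
have td (C : complexes A) n m :
    twist_unit (diff C n m) = diff (F C) n (twist_unit m).
  by rewrite -twist_unit_nat.
pose t (C : complexes A) : hom C (F C) :=
  @ChainMap A C (F C) (fun n => @twist_unit (term C n)) (@td C).
have tn (C D : complexes A) (f : hom C D) :
    heq (compose (t D) f) (compose (fhom F f) (t C)).
  by move=> n m; apply: esym (twist_unit_nat (f n) m).
exists (@NatTrans _ _ (id_functor _) F t tn) => C; apply: isomorphism_chain => n.
- exact: twist_unit_inj.
- exact: twist_unit_surj.
Qed.

Lemma twist_sqr :
  functor_iso (comp_functor (twist eps) (twist eps)) (id_functor (derived_category A)).
Proof. exact: induced_functor_sqr twist_complexes_sqr. Qed.

(** The twist is its own quasi-inverse: a map [T P] -> [N] amounts to a map [P] -> [T N]. The latter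
    is lifted through [Tmap p], and the lift is twisted back. *)
Lemma twist_projective (P : lmodType A) : projective P -> projective (T P).
Proof.
move=> P_proj M N p f p_surj.
have Tp_surj (v : T N) : exists u, Tmap p u = v.
  have [n ->] := unit_tensor_surj v; have [x <-] := p_surj n.
  by exists (unit x); rewrite unit_tensor_map.
have [g gE] := P_proj _ _ (Tmap p) (Tmap f \o @twist_unit P) Tp_surj.
pose w (u : T (T M)) : M := projT1 (cid (twist_unit_surj u)).
have wK u : twist_unit (w u) = u by rewrite /w; case: (cid _).
have w_lin : linear w by move=> a x y; apply: twist_unit_inj; rewrite twist_unit_linear !wK.
pose wl : {linear T (T M) -> M} := HB.pack w (GRing.isLinear.Build A _ _ _ w w_lin).
exists (wl \o Tmap g) => u; apply: twist_unit_inj.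
have [x ->] := unit_tensor_surj u.
transitivity (Tmap (Tmap p) (Tmap g (unit x))).
  by rewrite -[in RHS](wK (Tmap g (unit x))) twist_unit_nat.
rewrite !unit_tensor_map gE; congr (unit _); exact: unit_tensor_map.
Qed.

Lemma perfect_iso (C D : derived_category A) :
  isomorphic C D -> perfect C -> perfect D.
Proof.
move=> CD [P [h1 h2 CP]]; exists P; split=> //.
exact: isomorphic_trans (isomorphic_sym CD) CP.
Qed.

Lemma twist_perfect : preserves (@perfect A) (twist eps).
Proof.
move=> C [P [P_proj [N P_bd] [f If]]]; exists (twist eps P); split.
- by move=> n; apply: twist_projective.
- by exists N => n nN x; apply: tensor0; apply: P_bd.
- by exists (fhom (twist eps) f); apply: isomorphism_fhom.
Qed.
End TwistSquare.

(** * The Nakayama and Serre functors of an algebra with A^* isomorphic to a twist *)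

Section Nakayama.
Variables (k : fieldType) (A : kalgebra k) (A_fd : finite_dimensional A).
Variables (eps : involution A) (h : {linear twisted_bimodule eps -> dual_bimodule A}).
Hypothesis h_ract : forall x a, h (ract x a) = ract (h x) a.
Hypotheses (h_inj : injective h) (h_surj : forall y, exists x, y = h x).

Lemma twist_derived_nakayama :
  exists D : derived_nakayama A_fd, derived_functor D = twist eps.
Proof. exact/induced_left_derived/(tensor_functor_iso h_ract h_inj h_surj). Qed.

(** Every [nu] is isomorphic to the explicit derived functor given by the twist, and perfectness is
    invariant under isomorphism. The [inhabited] clause keeps the quantification over [nu] from
    being vacuous. *)
Lemma nakayama_serre :
  inhabited (derived_nakayama A_fd) /\
  forall nu : derived_nakayama A_fd,
    functor_iso nu (twist eps) /\
    exists (nu_perf : preserves (@perfect A) nu)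
           (eps_perf : preserves (@perfect A) (twist eps)),
      let S : functor (perf A) (perf A) := restrict nu_perf in
      functor_iso S (restrict eps_perf) /\
      functor_iso (comp_functor S S) (id_functor (perf A)).
Proof.
have [D DE] := twist_derived_nakayama; split; first by exists.
move=> nu; have nuE : functor_iso nu (twist eps).
  by rewrite -DE; apply: left_derived_unique.
split=> //; have eps_perf := @twist_perfect _ _ eps.
have nu_perf : preserves (@perfect A) nu.
  exact: preserves_iso (@perfect_iso _ A) (functor_iso_sym nuE) eps_perf.
exists nu_perf, eps_perf => S.
have SE : functor_iso S (restrict eps_perf) by apply: functor_iso_restrict.
split=> //; apply: functor_iso_trans (functor_iso_sqr SE) _.
exact: functor_iso_restrict_sqr (twist_sqr eps).
Qed.
End Nakayama.

(** * Frobenius forms *)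

Lemma dual0 (k : fieldType) (A : kalgebra k) (f : dual A) : f 0 = 0.
Proof. by apply: (addrI (f 0)); rewrite -dualD !addr0. Qed.

Lemma dualB (k : fieldType) (A : kalgebra k) (f : dual A) x y : f (x - y) = f x - f y.
Proof. by apply: (addIr (f y)); rewrite -dualD !subrK. Qed.

Lemma dual_sum (k : fieldType) (A : kalgebra k) (f : dual A) (T : finType) (F : T -> A)
  (P : pred T) : f (\sum_(t | P t) F t) = \sum_(t | P t) f (F t).
Proof. exact: (big_morph f (dualD f) (dual0 f)). Qed.

Lemma dual_mul_linear (k : fieldType) (A : kalgebra k) (f : dual A) (c : k) (x y z : A) :
  f (x * (alg_map A c * y + z)) = c * f (x * y) + f (x * z).
Proof. by rewrite mulrDr mulrA -alg_central -mulrA dualD dualZ. Qed.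

Section FrobeniusForm.
Variables (k : fieldType) (A : kalgebra k) (phi : dual A).
Variables (T : finType) (g h : T -> A).
Hypothesis casimir : forall x, x = \sum_t alg_map A (phi (h t * x)) * g t.

(* Both equations are required, which makes the relation symmetric and nakayama_aut
   an involution. *)
Definition nakayama_rel (x x' : A) : Prop :=
  forall y, phi (x * y) = phi (y * x') /\ phi (x' * y) = phi (y * x).

Hypothesis nakayama_ex : forall x, exists x', nakayama_rel x x'.

Lemma frobenius_inj x y : (forall z, phi (z * x) = phi (z * y)) -> x = y.
Proof.
by move=> e; rewrite [x]casimir [RHS]casimir; apply: eq_bigr => t _; rewrite e.
Qed.

Lemma frobenius_surj (f : dual A) : exists x, forall y, f y = phi (x * y).
Proof.
(* Applying f to the expansion of y gives the sum of phi (h_t y) f (g_t), which is phi of this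
   element times y. *)
exists (\sum_t alg_map A (f (g t)) * h t) => y.
rewrite {1}[y]casimir mulr_suml !dual_sum; apply: eq_bigr => t _.
by rewrite dualZ -mulrA dualZ mulrC.
Qed.

Definition nakayama_aut (x : A) : A := projT1 (cid (nakayama_ex x)).

Lemma nakayama_autP x : nakayama_rel x (nakayama_aut x).
Proof. by rewrite /nakayama_aut; case: (cid _). Qed.

(** This makes the choice canonical: each algebraic property of [nakayama_aut] is proved by checking
    that the expected value satisfies the relation. *)
Lemma nakayama_unique x x' : nakayama_rel x x' -> nakayama_aut x = x'.
Proof.
by move=> h'; apply: frobenius_inj => z; rewrite -(nakayama_autP x z).1 (h' z).1.
Qed.

Lemma nakayama_zmod : zmod_morphism nakayama_aut.
Proof.
move=> x y; apply: nakayama_unique => z.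
have [hx hy] := (nakayama_autP x z, nakayama_autP y z).
by rewrite !mulrBl !mulrBr !dualB hx.1 hx.2 hy.1 hy.2.
Qed.

Lemma nakayama_monoid : monoid_morphism nakayama_aut.
Proof.
split=> [|x y]; apply: nakayama_unique => z; first by rewrite !mul1r mulr1.
have [hx hy] := (nakayama_autP x, nakayama_autP y).
split; first by rewrite -mulrA (hx _).1 -mulrA (hy _).1 mulrA.
by rewrite -mulrA (hx _).2 -mulrA (hy _).2 mulrA.
Qed.

Lemma nakayama_aut_alg c : nakayama_aut (alg_map A c) = alg_map A c.
Proof. by apply: nakayama_unique => z; rewrite alg_central. Qed.

Lemma nakayama_autK : involutive nakayama_aut.
Proof.
move=> x; apply: nakayama_unique => z; have [h1 h2] := nakayama_autP x z.
by rewrite h1 h2.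
Qed.

Definition nakayama_morphism : {rmorphism A -> A} :=
  HB.pack nakayama_aut (GRing.isZmodMorphism.Build A A nakayama_aut nakayama_zmod)
    (GRing.isMonoidMorphism.Build A A nakayama_aut nakayama_monoid).

Definition nakayama_involution : involution A :=
  @Involution k A nakayama_morphism nakayama_aut_alg nakayama_autK.

Definition frobenius_map (x : twisted_bimodule nakayama_involution) : dual_bimodule A :=
  dual_lact (x : A) phi.

Lemma frobenius_map_linear : linear frobenius_map.
Proof.
move=> a x y; apply: dual_ext => z; rewrite [LHS]/=.
by rewrite mulrDr dualD mulrA.
Qed.
HB.instance Definition _ := GRing.isLinear.Build A
  (twisted_bimodule nakayama_involution) (dual_bimodule A) _ frobenius_map
  frobenius_map_linear.

(** At y this reads phi (y x eps(a)) = phi (a y x), the Nakayama relation for a; hence the twist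
    sits on the right side. *)
Lemma frobenius_map_ract x a : frobenius_map (ract x a) = ract (frobenius_map x) a.
Proof.
apply: dual_ext => y /=.
by rewrite -[a * y * x]mulrA (nakayama_autP a (y * x)).1 mulrA.
Qed.

Lemma frobenius_map_inj : injective frobenius_map.
Proof.
move=> x y e; apply: frobenius_inj => z.
exact: (congr1 (fun f : dual A => f z) e).
Qed.

Lemma frobenius_map_surj f : exists x, f = frobenius_map x.
Proof.
(* [frobenius_surj] represents f with x on the left, [frobenius_map] multiplies on the right; the
   automorphism exchanges the two. *)
have [x hx] := frobenius_surj f; exists (nakayama_aut x).
by apply: dual_ext => y; rewrite hx (nakayama_autP x y).1.
Qed.
End FrobeniusForm.

(** * Linear forms on quotients and completions *)

Lemma ideal_pow_ideal (R : pzRingType) (J : R -> Prop) n : ideal (ideal_pow J n).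
Proof. by case: n => [|n]; [split | apply: ideal_gen_ideal]. Qed.

(** The y such that f kills u y v for all u and v form a two-sided ideal; the factors u and v make
    the kernel condition stable under multiplication. *)
Lemma dual_ideal_gen (k : fieldType) (R : kalgebra k) (S : R -> Prop) (f : dual R) :
  (forall u x v, S x -> f (u * x * v) = 0) ->
  forall u x v, ideal_gen S x -> f (u * x * v) = 0.
Proof.
move=> fS u x v Sx; move: u v.
apply: (Sx (fun y => forall u v, f (u * y * v) = 0)) => [|y Sy u v]; last exact: fS.
split=> [u v|y z hy hz u v|a y hy u v|a y hy u v].
- by rewrite mulr0 mul0r dual0.
- by rewrite mulrDr mulrDl dualD hy hz addr0.
- by rewrite mulrA.
- by rewrite mulrA -mulrA.
Qed.

Lemma dual_quot (k : fieldType) (R : kalgebra k) (S : R -> Prop) (f : dual R) :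
  (forall u x v, S x -> f (u * x * v) = 0) ->
  exists f' : dual (quot S), forall x, f' (quot_pi S x) = f x.
Proof.
move=> fS; have fI x : ideal_gen S x -> f x = 0.
  by move/(dual_ideal_gen fS 1 1); rewrite mul1r mulr1.
have fE x : f (repr (quot_pi S x)) = f x.
  by apply/eqP; rewrite -subr_eq0 -dualB fI //; apply/quot_piE; rewrite quot_piK.
have fD (x y : quot S) : f (repr (x + y)) = f (repr x) + f (repr y).
  have [[u ->] [v ->]] := (quot_pi_surj x, quot_pi_surj y).
  by rewrite -rmorphD !fE dualD.
have fZ c (x : quot S) : f (repr (alg_map (quot S) c * x)) = c * f (repr x).
  have [u ->] := quot_pi_surj x.
  by rewrite -[alg_map _ _]/(quot_pi S (alg_map R c)) -rmorphM !fE dualZ.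
by exists (Dual fD fZ) => x; apply: fE.
Qed.

Lemma dual_completion (k : fieldType) (R : kalgebra k) (J : R -> Prop) n (f : dual R) :
  (forall x, ideal_pow J n x -> f x = 0) ->
  exists f' : dual (completion J),
    forall (y : completion J) x, level y n = quot_pi _ x -> f' y = f x.
Proof.
move=> fJ; have [_ _ Jl Jr] := ideal_pow_ideal J n.
have [|g gE] := @dual_quot k R (ideal_pow J n) f.
  by move=> u s v Js; apply: fJ; apply: Jr; apply: Jl.
have gD (x y : completion J) : g (level (x + y) n) = g (level x n) + g (level y n).
  exact: dualD.
have gZ c (x : completion J) : g (level (alg_map (completion J) c * x) n) = c * g (level x n).
  exact: (dualZ g).
by exists (Dual gD gZ) => y x /= ->; rewrite gE.
Qed.

Lemma levelM (R : pzRingType) (J : R -> Prop) n (x y : completion_ring J) a b :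
  level x n = quot_pi _ a -> level y n = quot_pi _ b ->
  level (x * y) n = quot_pi _ (a * b).
Proof.
move=> xa yb; apply: etrans (congr2 *%R xa yb) _.
exact: esym (rmorphM (quot_pi (ideal_pow J n)) a b).
Qed.

(** Telescoping: y is a convergent sum of differences of representatives, the n-th of which lies in
    J^(N + n), hence is z u_n with u_n in J^n. The series of the u_n converges to the quotient. *)
Lemma completion_divides (R : pzRingType) (J : R -> Prop) (z : R) N :
  (forall n x, ideal_pow J (N + n) x -> exists u, ideal_pow J n u /\ x = z * u) ->
  forall y : completion_ring J, level y N = 0 -> exists v, y = completion_map J z * v.
Proof.
move=> zJ y yN.
have lev_eq n x x' :
    quot_pi (ideal_pow J n) x = quot_pi (ideal_pow J n) x' <-> ideal_pow J n (x - x').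
  split=> [/quot_piE h|h]; first exact: (h _ (ideal_pow_ideal J n)).
  by apply/quot_piE; apply: ideal_genS.
have powS n x : ideal_pow J n.+1 x -> ideal_pow J n x.
  move=> h; apply: (h _ (ideal_pow_ideal J n)) => _ [a [b [_ hb ->]]].
  by have [_ _ pl _] := ideal_pow_ideal J n; apply: pl.
have powW n j x : ideal_pow J (n + j) x -> ideal_pow J n x.
  by elim: j => [|j IH]; rewrite ?addn0 // addnS => /powS.
pose r n := projT1 (cid (level_compat y n)).
have rE n : level y n.+1 = quot_pi _ (r n) /\ level y n = quot_pi _ (r n).
  by rewrite /r; case: (cid _).
have rS n : ideal_pow J n.+1 (r n.+1 - r n).
  by apply/lev_eq; rewrite -(rE n.+1).2 -(rE n).1.
(* The initial term is r_N itself; it lies in J^N because y vanishes at level N. *)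
pose d n := r (N + n)%N - (if n is n'.+1 then r (N + n')%N else 0).
have dJ n : ideal_pow J (N + n)%N (d n).
  rewrite /d; case: n => [|n]; last by rewrite addnS; apply: rS.
  by rewrite addn0; apply/lev_eq; rewrite rmorph0 -yN (rE N).2.
pose u n := projT1 (cid (zJ _ _ (dJ n))).
have uE n : ideal_pow J n (u n) /\ d n = z * u n by rewrite /u; case: (cid _).
(* The u_j with j >= n lie in J^n, so this finite sum is the whole series at level n. *)
pose v n : quot_ring (ideal_pow J n) := quot_pi _ (\sum_(j < n) u j).
have v_compat n : exists x, v n.+1 = quot_pi _ x /\ v n = quot_pi _ x.
  exists (\sum_(j < n.+1) u j); split=> //; apply/lev_eq.
  rewrite big_ord_recr /= opprD addrA subrr add0r.
  exact: (idealN (ideal_pow_ideal J n) (uE n).1).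
have zu n : \sum_(j < n.+1) z * u j = r (N + n)%N.
  elim: n => [|n IH]; first by rewrite big_ord1 -(uE 0%N).2 /d subr0.
  by rewrite big_ord_recr IH /= -(uE n.+1).2 /d addrC subrK.
exists (Completion v_compat); apply: completion_eq => n.
apply: etrans _ (rmorphM (quot_pi (ideal_pow J n)) z (\sum_(j < n) u j)).
rewrite mulr_sumr; case: n => [|n].
  by have [x ->] := quot_pi_surj (level y 0); apply/lev_eq.
(* The partial sum is r_(N + n), whereas level n + 1 of y is given by r_n; the two agree modulo J^(n
   + 1), as all later increments lie there. *)
rewrite zu addnC; elim: N {yN zJ d dJ u uE v v_compat zu} => [|N IH].
  by rewrite addn0 (rE n).1.
rewrite IH addnS; apply: esym; apply/lev_eq.
by apply: (@powW _ N); rewrite addSn; apply: rS.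
Qed.

(** * Paths along sigma *)

Section PathProducts.
Variables (k : fieldType) (Q : quiver).

Lemma of_path_comp (p q r : qpath Q) : path_start p = path_end q ->
  val r = ((val q).1, (val q).2 ++ (val p).2) ->
  of_path k p * of_path k q = of_path k r.
Proof.
move=> pq vr; rewrite -[_ * _]/(path_mul _ _) of_pathM.
have [[]//|[_ [s [-> _ _ vs]]]] := path_comp_spec p q.
by congr of_path; apply: val_inj; rewrite vs.
Qed.

Lemma of_path_comp0 (p q : qpath Q) : path_start p <> path_end q ->
  of_path k p * of_path k q = 0.
Proof.
move=> pq; rewrite -[_ * _]/(path_mul _ _) of_pathM.
by have [[_ ->]|[]] := path_comp_spec p q.
Qed.

Lemma of_pathM_cases (p q : qpath Q) : of_path k p * of_path k q = 0 \/
  exists r, of_path k p * of_path k q = of_path k r /\ (val r).2 = (val q).2 ++ (val p).2.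
Proof.
rewrite -[_ * _]/(path_mul _ _) of_pathM.
have [[_ ->]|[_ [s [-> _ _ vs]]]] := path_comp_spec p q; first by left.
by right; exists s; rewrite vs.
Qed.

Lemma path_scaleE (c : k) (f : path_ring k Q) : c *: f = alg_map (path_algebra k Q) c * f.
Proof.
by rewrite -[alg_map _ c]/(c *: (1 : path_ring k Q)) -path_scalerAl mul1r.
Qed.
End PathProducts.

Section SigmaPaths.
Variables (k : fieldType) (Q : gentle_quiver k).
Local Notation I := (@gentle_ideal k Q).
Local Notation sg := (sigma Q).

Lemma gentle_ideal_ideal : ideal I.
Proof.
have [_ _ [S [_ hS]]] := gentleP Q.
have [I0 ID Il Ir] := ideal_gen_ideal (fun y => exists2 p, S p & y = of_path k p).
split=> [|x y /hS hx /hS hy|a x /hS hx|a x /hS hx]; apply/hS;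
  [exact: I0|exact: ID|exact: Il|exact: Ir].
Qed.

Lemma gentle_arrowP (b c : arrow Q) :
  c <> sg b -> I (arrow_elt k c * arrow_elt k b).
Proof.
by move=> ne; apply: contrapT => /sigma_funP e; apply: ne; rewrite permE.
Qed.

(** Otherwise the product of the two arrows would be 0, which lies in I. *)
Lemma src_sigma (a : arrow Q) : src (sg a) = tgt a.
Proof.
apply: contrapT => ne; have : ~ I (arrow_elt k (sg a) * arrow_elt k a).
  by apply/sigma_funP; rewrite permE.
have [I0 _ _ _] := gentle_ideal_ideal.
by rewrite /arrow_elt of_path_comp0.
Qed.

Lemma walk_sigma (a : arrow Q) l : walk (src a) (traject sg a l).
Proof. by elim: l a => [|l IH] a /=; rewrite ?eqxx -?src_sigma ?IH. Qed.

(* The trivial path at src a if l = 0. *)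
Definition sigma_path (a : arrow Q) (l : nat) : qpath Q :=
  Sub (src a, traject sg a l) (walk_sigma a l).

Lemma sigma_path_end a l : path_end (sigma_path a l) = src (iter l sg a).
Proof.
rewrite /path_end SubK /=; case: l => // l; rewrite trajectSr map_rcons last_rcons.
by rewrite -src_sigma -iterS.
Qed.

Lemma sigma_pathM a l l' :
  of_path k (sigma_path (iter l sg a) l') * of_path k (sigma_path a l) =
  of_path k (sigma_path a (l + l')).
Proof.
apply: of_path_comp; first by rewrite sigma_path_end.
by rewrite !SubK /= trajectD.
Qed.

Lemma sigma_pathM0 a l a' l' : src a' <> src (iter l sg a) ->
  of_path k (sigma_path a' l') * of_path k (sigma_path a l) = 0.
Proof. by move=> h; apply: of_path_comp0; rewrite sigma_path_end. Qed.

Lemma sigma_path1 a : of_path k (sigma_path a 1) = arrow_elt k a.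
Proof. by congr of_path; apply: val_inj. Qed.

Lemma sigma_path0 a a' : src a = src a' -> sigma_path a 0 = sigma_path a' 0.
Proof. by move=> h; apply: val_inj; rewrite /= h. Qed.

(** Bundling the morphism lets one calculus of paths serve kQ/I, its completion and the twisted
    Brauer graph algebra. *)
Record gentle_rep (C : kalgebra k) := GentleRep {
  rep :> {rmorphism path_ring k Q -> C};
  rep_const : forall c, rep (alg_map (path_algebra k Q) c) = alg_map C c;
  rep_ideal : forall x, I x -> rep x = 0 }.

Lemma out_arrow (i : vertex Q) : exists a : arrow Q, src a = i.
Proof.
have [h _ _] := gentleP Q; have [/eqP/cards2P[a [b [_ e]]] _] := h i.
by exists a; apply/eqP; have := set21 a b; rewrite -e inE.
Qed.

End SigmaPaths.

HB.lock Definition sp (k : fieldType) (Q : gentle_quiver k) (C : kalgebra k)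
    (rho : gentle_rep Q C) (a : arrow Q) (l : nat) : C :=
  rho (of_path k (sigma_path a l)).

(** * Multiplication and spans of images of paths along sigma *)

Section Rep.
Variables (k : fieldType) (Q : gentle_quiver k) (C : kalgebra k) (rho : gentle_rep Q C).
Local Notation sg := (sigma Q).
Local Notation sp := (sp rho).

Lemma spE a l : sp a l = rho (of_path k (sigma_path a l)).
Proof. by rewrite unlock. Qed.

Lemma sp_cat a l l' : sp (iter l sg a) l' * sp a l = sp a (l + l').
Proof. by rewrite !spE -rmorphM sigma_pathM. Qed.

Lemma sp0 a a' : src a = src a' -> sp a 0 = sp a' 0.
Proof. by rewrite !spE => /sigma_path0 ->. Qed.

Lemma spM_nil a l a' l' : src a' <> src (iter l sg a) -> sp a' l' * sp a l = 0.
Proof. by move=> h; rewrite !spE -rmorphM sigma_pathM0 // rmorph0. Qed.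

Lemma spM0 a a' l : sp a' l * sp a 0 = if src a' == src a then sp a' l else 0.
Proof.
case: eqP => h; last by rewrite spM_nil.
by rewrite (@sp0 a a') // (@sp_cat a' 0 l).
Qed.

Lemma sp0M a l a' : sp a' 0 * sp a l = if src a' == src (iter l sg a) then sp a l else 0.
Proof.
case: eqP => h; last by rewrite spM_nil.
by rewrite (@sp0 a' (iter l sg a)) // sp_cat addn0.
Qed.

(** If [a'] does not continue the first path along sigma, the two arrows at the junction form a
    product in I. Lengths are positive because [sp a 0] depends on [src a] only and has no arrow at
    the junction. *)
Lemma spM a l a' l' : (0 < l)%N -> (0 < l')%N ->
  sp a' l' * sp a l = if a' == iter l sg a then sp a (l + l') else 0.
Proof.
case: l => // l _; case: l' => // l' _; case: eqP => [->|ne]; first by rewrite sp_cat.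
have el : sp a l.+1 = sp (iter l sg a) 1 * sp a l by rewrite sp_cat addn1.
have el' : sp a' l'.+1 = sp (sg a') l' * sp a' 1 by rewrite (@sp_cat a' 1 l') add1n.
have e0 : sp a' 1 * sp (iter l sg a) 1 = 0.
  by rewrite !spE -rmorphM !sigma_path1; apply: rep_ideal; apply: gentle_arrowP.
have mul4 (x y z t : C) : y * z = 0 -> x * y * (z * t) = 0.
  by move=> yz; rewrite mulrA -(mulrA x) yz mulr0 mul0r.
by rewrite el el' mul4.
Qed.

Lemma spM_cases a l a' l' :
  sp a' l' * sp a l = 0 \/ exists c, sp a' l' * sp a l = sp c (l + l').
Proof.
case: l => [|l]; first by rewrite spM0; case: eqP => _; [right; exists a'|left].
case: l' => [|l']; last by rewrite spM //; case: eqP => _; [right; exists a|left].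
by rewrite sp0M addn0; case: eqP => _; [right; exists a|left].
Qed.

(** Arrows are appended one at a time: each step either continues along sigma or annihilates the
    image. Hence the [sp a l] span the image of [rho]. *)
Lemma rep_path (p : qpath Q) : rho (of_path k p) = 0 \/
  exists a, rho (of_path k p) = sp a (path_length p).
Proof.
case: p => -[i w]; elim/last_ind: w => [|w c IH] hw.
  right; have [a ai] := out_arrow i; exists a.
  by rewrite spE; congr (rho (of_path k _)); apply: val_inj; rewrite /= ai.
have : walk i (w ++ [:: c]) by rewrite cats1; apply: hw.
rewrite walk_cat => /andP[hw' /andP[/eqP hc _]].
have -> : rho (of_path k (exist _ (i, rcons w c) hw)) =
    sp c 1 * rho (of_path k (exist _ (i, w) hw')).
  rewrite !spE -rmorphM; congr (rho _); symmetry; apply: of_path_comp => //=.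
  by rewrite cats1.
rewrite /path_length /= size_rcons.
have [->|[a ->]] := IH hw'; first by left; rewrite mulr0.
by have [->|[d ->]] := spM_cases a (size w) c 1; [left|right; exists d; rewrite addn1].
Qed.

Lemma rep_ind (P : C -> Prop) :
  P 0 -> (forall a l, P (sp a l)) ->
  (forall c x y, P x -> P y -> P (alg_map C c * x + y)) -> forall f, P (rho f).
Proof.
move=> P0 Psp PD; elim/path_ring_ind => [|p|c x y Px Py]; first by rewrite rmorph0.
  by have [->|[a ->]] := rep_path p.
by rewrite rmorphD path_scaleE rmorphM rep_const; apply: PD.
Qed.

Lemma sp_prod a l :
  \prod_(b <- rev (traject sg a l.+1)) rho (arrow_elt k b) = sp a l.+1.
Proof.
elim: l => [|l IH]; first by rewrite big_seq1 spE sigma_path1.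
rewrite trajectSr rev_rcons big_cons IH -[l.+2]addn1 -sp_cat; congr (_ * _).
by rewrite spE sigma_path1.
Qed.

Lemma sp_expr a l j : iter l sg a = a -> (0 < j)%N -> sp a l ^+ j = sp a (j * l).
Proof.
move=> ea; case: j => // j _; elim: j => [|j IH]; first by rewrite mul1n.
by have := sp_cat a l (j.+1 * l); rewrite ea exprSr IH.
Qed.

(** The linear span of the paths of length at least n, encoded as the intersection of the subspaces
    containing them, so that membership is itself an induction principle. *)
Definition sp_span n (x : C) : Prop := forall P : C -> Prop,
  P 0 -> (forall c x y, P x -> P y -> P (alg_map C c * x + y)) ->
  (forall a l, (n <= l)%N -> P (sp a l)) -> P x.

Lemma sp_span0 n : sp_span n 0.
Proof. by []. Qed.

Lemma sp_spanP n c x y : sp_span n x -> sp_span n y -> sp_span n (alg_map C c * x + y).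
Proof. by move=> hx hy P P0 PD Psp; apply: (PD); [apply: hx|apply: hy]. Qed.

Lemma sp_span_sp n a l : (n <= l)%N -> sp_span n (sp a l).
Proof. by move=> h P _ _; apply. Qed.

Lemma sp_spanM n j x y : sp_span n x -> sp_span j y -> sp_span (n + j) (x * y).
Proof.
move=> hx hy; apply: (hx (fun x => sp_span (n + j) (x * y))) => [|c u v|a l al].
- by rewrite mul0r; apply: sp_span0.
- by rewrite mulrDl -mulrA; apply: sp_spanP.
apply: (hy (fun y => sp_span (n + j) (sp a l * y))) => [|c u v|b l' bl].
- by rewrite mulr0; apply: sp_span0.
- by rewrite mulrDr mulrA -alg_central -mulrA; apply: sp_spanP.
have [->|[c ->]] := spM_cases b l' a l; first exact: sp_span0.
by apply: sp_span_sp; rewrite addnC leq_add.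
Qed.

Hypothesis rho_surj : forall x, exists f, x = rho f.

Lemma sp_spanT x : sp_span 0 x.
Proof.
have [f ->] := rho_surj x; apply: rep_ind; [exact: sp_span0| |exact: sp_spanP].
by move=> a l; apply: sp_span_sp.
Qed.

Lemma sp_span_ideal n : ideal (sp_span n).
Proof.
split; first exact: sp_span0.
- by move=> x y hx hy; rewrite -[x]mul1r -(rmorph1 (alg_map C)); apply: sp_spanP.
- by move=> a x hx; rewrite -[n]add0n; apply: sp_spanM => //; apply: sp_spanT.
- by move=> a x hx; rewrite -[n]addn0; apply: sp_spanM => //; apply: sp_spanT.
Qed.
End Rep.

(** * The Frobenius form on paths along sigma *)

Section ArrowSigns.
Variables (k : fieldType) (Q : gentle_quiver k).

(* The pick only depends on src a, hence selects one of the two arrows at each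
   vertex. *)
Definition top_arrow (a : arrow Q) : bool := [pick b : arrow Q | src b == src a] == Some a.

End ArrowSigns.

HB.lock Definition arrow_sign (k : fieldType) (Q : gentle_quiver k) (a : arrow Q) : k :=
  if top_arrow a then 1 else -1.

HB.lock Definition cycle_length (k : fieldType) (Q : gentle_quiver k)
    (m : {set arrow Q} -> nat) (a : arrow Q) : nat :=
  (m (porbit (sigma Q) a) * #|porbit (sigma Q) a|)%N.

Section ArrowSigns.
Variables (k : fieldType) (Q : gentle_quiver k).
Local Notation arrow_sign := (@arrow_sign k Q).

Lemma arrow_signE a : arrow_sign a = if top_arrow a then 1 else -1.
Proof. by rewrite unlock. Qed.

Lemma arrow_sign_sqr a : arrow_sign a * arrow_sign a = 1.
Proof. by rewrite arrow_signE; case: ifP; rewrite ?mulrNN mul1r. Qed.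

Lemma out_arrows (i : vertex Q) : exists a b : arrow Q,
  [/\ top_arrow a, ~~ top_arrow b, forall c, (src c == i) = (c == a) || (c == b) &
      forall (V : nmodType) (F : arrow Q -> V), \sum_(c | src c == i) F c = F a + F b].
Proof.
have [h _ _] := gentleP Q; have [/eqP/cards2P[a [b [ab e]]] _] := h i.
have inE' c : (src c == i) = (c == a) || (c == b).
  by have := in_set2 c a b; rewrite -e inE.
have sa : src a = i by apply/eqP; rewrite inE' eqxx.
have sb : src b = i by apply/eqP; rewrite inE' eqxx orbT.
have sum (V : nmodType) (F : arrow Q -> V) : \sum_(c | src c == i) F c = F a + F b.
  rewrite (bigD1 a) ?sa //= (bigD1 b) /= ?sb ?eqxx 1?eq_sym //.
  rewrite big1 ?addr0 // => c; rewrite inE'.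
  by case: (c == a); case: (c == b).
have topE c : src c = i -> top_arrow c = ([pick b : arrow Q | src b == i] == Some c).
  by rewrite /top_arrow => ->.
move: topE; case: pickP => [d|none]; last by have := none a; rewrite sa eqxx.
rewrite inE' => /orP[]/eqP -> topE; first by exists a, b; split; rewrite ?topE.
exists b, a; split; rewrite ?topE // 1?eq_sym //; first by move=> c; rewrite inE' orbC.
by move=> V F; rewrite sum addrC.
Qed.

Lemma top_arrow_unique a b : src a = src b -> @top_arrow k Q a -> top_arrow b -> a = b.
Proof. by rewrite /top_arrow => -> /eqP -> /eqP[]. Qed.

(** This cancellation is what lets the form vanish on z times a trivial path. *)
Lemma arrow_sign_sum i : \sum_(c : arrow Q | src c == i) arrow_sign c = 0.
Proof.
have [a [b [ta tb _ ->]]] := out_arrows i.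
by rewrite !arrow_signE ta (negPf tb) subrr.
Qed.

Variable m : {set arrow Q} -> nat.
Hypothesis m_gt0 : forall v, v \in porbits (sigma Q) -> (0 < m v)%N.
Local Notation sg := (sigma Q).

Local Notation e := (cycle_length m).

Lemma cycle_lengthE a : e a = (m (porbit sg a) * #|porbit sg a|)%N.
Proof. by rewrite unlock. Qed.

Lemma cycle_length_gt0 a : (0 < e a)%N.
Proof.
rewrite cycle_lengthE muln_gt0 m_gt0 ?imset_f //=.
by apply/card_gt0P; exists a; apply: porbit_id.
Qed.

Lemma iter_cycle_length a : iter (e a) sg a = a.
Proof. by rewrite cycle_lengthE; elim: (m _) => //= j IH; rewrite mulSn iterD IH iter_porbit. Qed.

Lemma cycle_length_iter a l : e (iter l sg a) = e a.
Proof.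
rewrite !cycle_lengthE; suff -> : porbit sg (iter l sg a) = porbit sg a by [].
by apply/eqP; rewrite eq_porbit_mem -permX mem_porbit.
Qed.

Lemma iter_sigma_inj l : injective (iter l sg).
Proof. by elim: l => //= l IH a b /perm_inj /IH. Qed.
End ArrowSigns.

Section GentleForm.
Variables (k : fieldType) (Q : gentle_quiver k) (m : {set arrow Q} -> nat).
Hypothesis m_gt0 : forall v, v \in porbits (sigma Q) -> (0 < m v)%N.
Variables (C : kalgebra k) (rho : gentle_rep Q C).
Hypothesis rho_surj : forall x, exists f, x = rho f.
Local Notation sg := (sigma Q).
Local Notation e := (cycle_length m).
Local Notation sp := (sp rho).
Local Notation s := (@arrow_sign k Q).
Hypothesis sp_long : forall a l, (e a < l)%N -> sp a l = 0.
Hypothesis sp_sum : forall i, \sum_(c : arrow Q | src c == i) sp c (e c) = 0.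
Variable phi : dual C.
Hypothesis phi_sp : forall a l, phi (sp a l) = if l == e a then s a else 0.

Let e_gt0 a : (0 < e a)%N := cycle_length_gt0 m_gt0 a.

Lemma phi_sp0M a a' l : phi (sp a 0 * sp a' l) =
  if (l == e a') && (src a == src a') then s a' else 0.
Proof.
rewrite sp0M; case: (l =P e a') => [->|ne].
  by rewrite iter_cycle_length; case: eqP; rewrite ?dual0 // phi_sp eqxx.
by case: eqP; rewrite ?dual0 // phi_sp; case: eqP.
Qed.

Lemma phi_spM0 a a' l : phi (sp a' l * sp a 0) =
  if (l == e a') && (src a' == src a) then s a' else 0.
Proof. by rewrite spM0; do 2 case: eqP; rewrite ?dual0 // phi_sp; case: eqP. Qed.

Lemma phi_spM a l a' l' : (0 < l)%N -> (0 < l')%N -> phi (sp a' l' * sp a l) =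
  if (a' == iter l sg a) && ((l + l')%N == e a) then s a else 0.
Proof. by move=> l0 l'0; rewrite spM //; case: eqP; rewrite ?dual0 ?phi_sp. Qed.

(** When either side is nonzero, the two paths close up to a maximal cycle, read from [a] or from
    [a' = iter l sg a]; phi gives [s a] and [s a'] respectively. The ratio depends on the path
    [sp a l] alone. *)
Lemma phi_spC a l a' l' :
  phi (sp a l * sp a' l') = s a * s (iter l sg a) * phi (sp a' l' * sp a l).
Proof.
case: l => [|l].
  by rewrite phi_sp0M phi_spM0 [iter _ _ _]/= arrow_sign_sqr mul1r [src a == _]eq_sym.
case: l' => [|l'].
  rewrite phi_spM0 phi_sp0M [src a == _]eq_sym; case: (l.+1 =P e a) => [->|_] /=.
    by rewrite iter_cycle_length arrow_sign_sqr mul1r.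
  by rewrite mulr0.
rewrite !phi_spM // [(l.+1 + _)%N]addnC.
have sym b j b' j' : b = iter j sg b' -> (j + j')%N = e b' ->
    b' = iter j' sg b /\ (j + j')%N = e b.
  move=> -> ej; rewrite -iterD addnC ej iter_cycle_length.
  by rewrite cycle_length_iter.
case: (a =P iter l'.+1 sg a') => [ea|na] /=; last first.
  case: (a' =P iter l.+1 sg a) => [ea'|_] /=; last by rewrite mulr0.
  case: eqP => [el|_]; last by rewrite mulr0.
  by have [] := sym a' l.+1 a l'.+1 ea'; rewrite 1?addnC.
case: eqP => [el|ne].
  have [/= ea' ela] := sym a l'.+1 a' l.+1 ea el.
  by rewrite -ea' eqxx ela eqxx /= mulrAC arrow_sign_sqr mul1r.
case: (a' =P iter l.+1 sg a) => [ea'|_] /=; last by rewrite mulr0.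
case: eqP => [el|_]; last by rewrite mulr0.
by have [] := sym a' l.+1 a l'.+1 ea'; rewrite 1?addnC.
Qed.

(** The relation is linear, so it suffices to treat [sp a l], where x' is a scalar multiple of x.
    The scalar c is a product of two signs, and c c = 1 gives the second equation. *)
Lemma gentle_nakayama_ex x : exists x', nakayama_rel phi x x'.
Proof.
have [f ->] := rho_surj x; apply: (@rep_ind _ _ _ rho (fun x => exists x', nakayama_rel phi x x')).
- by exists 0 => y; rewrite !(mul0r, mulr0) dual0.
- move=> a l.
  have [c [cc spC0]] : exists c, c * c = 1 /\
      forall b j, phi (sp a l * sp b j) = c * phi (sp b j * sp a l).
    exists (s a * s (iter l sg a)); split; last by move=> b j; apply: phi_spC.
    by rewrite mulrACA !arrow_sign_sqr mul1r.
  have spC y : phi (sp a l * y) = c * phi (y * sp a l).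
    have [g ->] := rho_surj y.
    apply: (@rep_ind _ _ _ rho (fun y => phi (sp a l * y) = c * phi (y * sp a l))).
    + by rewrite mulr0 mul0r dual0 mulr0.
    + exact: spC0.
    + move=> d u v hu hv.
      rewrite mulrDr mulrDl !dualD mulrA -alg_central -!mulrA !dualZ hu hv mulrDr.
      by rewrite mulrCA.
  exists (alg_map C c * sp a l) => y; split.
    by rewrite spC mulrA -alg_central -mulrA dualZ.
  by rewrite -mulrA dualZ spC mulrA cc mul1r.
move=> c x1 x2 [x1' h1] [x2' h2]; exists (alg_map C c * x1' + x2') => y.
have [[h11 h12] [h21 h22]] := (h1 y, h2 y).
rewrite !mulrDl !mulrDr !dualD -!mulrA !dualZ h11 h12 h21 h22; split; congr (_ + _).
  by rewrite mulrA -alg_central -mulrA dualZ.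
by rewrite mulrA -[y * alg_map C c]alg_central -mulrA dualZ.
Qed.

(* The basis formed by the sp a l with 0 < l < e a and, for the chosen arrow a at
   each vertex, sp a 0 and sp a (e a), is padded with zeros; gentle_cobasis
   is dual to it. *)
Definition gentle_index : finType :=
  ((arrow Q * 'I_(\max_a e a)) + (arrow Q + arrow Q))%type.

(** The factor [s a] cancels the value of phi on the cycle at [a]; at a top arrow the sign is 1. *)
Definition gentle_basis (t : gentle_index) : C := match t with
  | inl (a, l) => if (0 < l < e a)%N then alg_map C (s a) * sp a l else 0
  | inr (inl a) => if top_arrow a then sp a 0 else 0
  | inr (inr a) => if top_arrow a then sp a (e a) else 0
  end.

(** Each entry is the complement that closes the corresponding basis path to a maximal cycle. *)
Definition gentle_cobasis (t : gentle_index) : C := match t with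
  | inl (a, l) => sp (iter l sg a) (e a - l)
  | inr (inl a) => sp a (e a)
  | inr (inr a) => sp a 0
  end.

(** A nonzero value requires the second path to end where the complement starts and the lengths to
    add up to the cycle length. As that length is constant on orbits, l = l', and injectivity of the
    iterates of sigma gives a = a'. *)
Lemma phi_complement a l a' l' : (0 < l < e a)%N ->
  phi (sp (iter l sg a) (e a - l) * sp a' l') =
  if (a == a') && (l == l') then s a' else 0.
Proof.
move=> /andP[l0 le]; case: l' => [|l'].
  have -> : (l == 0)%N = false by case: l l0 {le}.
  rewrite phi_spM0 cycle_length_iter andbF.
  by have -> : (e a - l == e a)%N = false by apply/eqP; lia.
rewrite phi_spM ?subn_gt0 //; case: (a =P a') => [<-|ne] /=.
  case: (l =P l'.+1) => [ll|ne]; first by subst l; rewrite eqxx subnKC ?eqxx // ltnW.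
  by case: (_ =P e a) => [el|_]; [exfalso; lia|rewrite andbF].
case: (iter l sg a =P sg (iter l' sg a')) => //= h.
have ee : e a = e a'.
  by rewrite -(cycle_length_iter m a l) h (cycle_length_iter m a' l'.+1).
case: eqP => // el; have ll : l = l'.+1 by lia.
by case: ne; apply: (@iter_sigma_inj _ _ l); rewrite h ll.
Qed.

Lemma gentle_casimir x :
  x = \sum_t alg_map C (phi (gentle_cobasis t * x)) * gentle_basis t.
Proof.
have [f ->] := rho_surj x.
apply: (@rep_ind _ _ _ rho (fun x =>
  x = \sum_t alg_map C (phi (gentle_cobasis t * x)) * gentle_basis t)).
- by rewrite big1 // => t _; rewrite mulr0 dual0 rmorph0 mul0r.
- move=> a' l'; rewrite !big_sumType /=.
  have -> : \sum_(t : arrow Q * 'I_(\max_a e a))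
      alg_map C (phi (gentle_cobasis (inl t) * sp a' l')) * gentle_basis (inl t) =
      if (0 < l' < e a')%N then sp a' l' else 0.
    case: ifP => [/andP[l0 le]|nl].
      have lL : (l' < \max_a e a)%N by apply: leq_trans le (leq_bigmax a').
      rewrite (bigD1 (a', Ordinal lL)) //= l0 le /= phi_complement ?l0 //.
      rewrite !eqxx /= mulrA -rmorphM arrow_sign_sqr rmorph1 mul1r.
      rewrite big1 ?addr0 // => -[a l] /= ne; case: ifP => [hl|_]; last by rewrite mulr0.
      rewrite phi_complement //; case: ifP => [/andP[/eqP ea /eqP el]|_].
        by case/eqP: ne; rewrite ea; congr pair; apply: val_inj.
      by rewrite rmorph0 mul0r.
    rewrite big1 // => -[a l] _ /=; case: ifP => [hl|_]; last by rewrite mulr0.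
    rewrite phi_complement //; case: ifP => [/andP[/eqP ea /eqP el]|_].
      by move: hl; rewrite ea el nl.
    by rewrite rmorph0 mul0r.
  have [t [b [tt tb srcE sum]]] := out_arrows (src a').
  have st : src t = src a' by apply/eqP; rewrite srcE eqxx.
  have top_sum (F : arrow Q -> C) :
      \sum_a (if (src a == src a') && top_arrow a then F a else 0) = F t.
    rewrite (bigD1 t) //= st eqxx tt /= big1 ?addr0 // => c ct.
    case: ifP => // /andP[/eqP sc tc]; case/eqP: ct.
    by apply: top_arrow_unique => //; rewrite st.
  have -> : \sum_a alg_map C (phi (gentle_cobasis (inr (inl a)) * sp a' l')) *
      gentle_basis (inr (inl a)) = if l' == 0%N then sp a' 0 else 0.
    case: l' => [|l'] /=.
      rewrite -(@sp0 _ _ _ rho t a' st) -[RHS](top_sum (fun a => sp t 0)).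
      apply: eq_bigr => a _; case: ifP => ta; last by rewrite andbF mulr0.
      rewrite phi_spM0 eqxx andbT /= st.
      case: eqP => [sa|_]; last by rewrite rmorph0 mul0r.
      by rewrite arrow_signE ta rmorph1 mul1r; apply: sp0; rewrite sa st.
    rewrite big1 // => a _; case: ifP => _; last by rewrite mulr0.
    rewrite phi_spM //; case: ifP => [/andP[/eqP ea /eqP el]|_]; last by rewrite rmorph0 mul0r.
    by move: el; rewrite ea cycle_length_iter; lia.
  have -> : \sum_a alg_map C (phi (gentle_cobasis (inr (inr a)) * sp a' l')) *
      gentle_basis (inr (inr a)) = if l' == e a' then sp a' (e a') else 0.
    rewrite /=; case: (l' =P e a') => [->|ne]; last first.
      rewrite big1 // => a _; rewrite phi_sp0M; case: eqP => //= _.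
      by rewrite rmorph0 mul0r.
    (* Only the top arrow t at the vertex contributes. If [a'] is the other arrow, its sign is -1
       and [sp_sum] turns - [sp t (e t)] into the cycle at [a']. *)
    transitivity (alg_map C (s a') * sp t (e t)).
      rewrite -(top_sum (fun a => alg_map C (s a') * sp a (e a))).
      apply: eq_bigr => a _; rewrite phi_sp0M eqxx /=.
      case: eqP => /= _; last by rewrite rmorph0 mul0r.
      by case: ifP => // _; rewrite mulr0.
    have := sp_sum (src a'); rewrite sum => stb.
    rewrite arrow_signE; case: ifP => ta.
      by rewrite rmorph1 mul1r (top_arrow_unique st tt ta).
    have -> : a' = b.
      by have := srcE a'; rewrite eqxx => /esym/orP[]/eqP // at'; rewrite at' tt in ta.
    by rewrite rmorphN1 mulN1r; apply/eqP; rewrite eq_sym -addr_eq0 addrC stb.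
  (* Exactly one of the three sums survives if l' <= e a', and none beyond, where the path is
     zero. *)
  case: l' => [|l'] /=.
    case: eqP => [e0|_]; last by rewrite add0r addr0.
    by have := e_gt0 a'; rewrite -e0.
  rewrite add0r; case: (ltngtP l'.+1 (e a')) => [||->]; rewrite ?addr0 ?add0r //.
  exact: sp_long.
move=> c y z hy hz; rewrite {1}hy {1}hz mulr_sumr -big_split; apply: eq_bigr => t _ /=.
by rewrite dual_mul_linear rmorphD rmorphM mulrDl mulrA.
Qed.
End GentleForm.

(** * Twisted Brauer graph algebras *)

Lemma path_dual (k : fieldType) (Q : quiver) (h : qpath Q -> k) :
  exists f : dual (path_algebra k Q), forall p, f (of_path k p) = h p.
Proof.
pose F (x : path_ring k Q) : k := \sum_(p <- msupp x) x@_p * h p.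
have FE (d : {fset qpath Q}) x : (msupp x `<=` d)%fset -> F x = \sum_(p <- d) x@_p * h p.
  move=> le; rewrite /F (big_fset_incl _ le) //= => p _ /mcoeff_outdom ->.
  by rewrite mul0r.
have FD (x y : path_algebra k Q) : F (x + y) = F x + F y.
  pose d := (msupp (x : path_ring k Q) `|` msupp (y : path_ring k Q))%fset.
  rewrite (FE d) ?(FE d x) ?(FE d y) ?fsubsetUl ?fsubsetUr //; last exact: msuppD_le.
  by rewrite -big_split; apply: eq_bigr => p _ /=; rewrite mcoeffD mulrDl.
have FZ c (x : path_algebra k Q) : F (alg_map (path_algebra k Q) c * x) = c * F x.
  rewrite -path_scaleE (FE (msupp (x : path_ring k Q))); last exact: msuppZ_le.
  by rewrite /F mulr_sumr; apply: eq_bigr => p _; rewrite mcoeffZ mulrA.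
exists (Dual FD FZ) => p /=.
by rewrite (FE [fset p]%fset) ?msuppU_le // big_seq_fset1 mcoeffUU mul1r.
Qed.

Lemma path_algebra_ind (k : fieldType) (Q : quiver) (P : path_algebra k Q -> Prop) :
  P 0 -> (forall p, P (of_path k p)) ->
  (forall c x y, P x -> P y -> P (alg_map (path_algebra k Q) c * x + y)) ->
  forall x, P x.
Proof.
move=> P0 Pp PD; apply: path_ring_ind => // c x y Px Py.
by rewrite path_scaleE; apply: PD.
Qed.

(** The first hypothesis expresses, as an induction principle, that [g] spans [R]; the conclusion
    follows by bilinearity in u and v. *)
Lemma dual_span2 (k : fieldType) (R : kalgebra k) (T : Type) (g : T -> R) (f : dual R) (x : R) :
  (forall P : R -> Prop, P 0 -> (forall t, P (g t)) ->
     (forall c y z, P y -> P z -> P (alg_map R c * y + z)) -> forall y, P y) ->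
  (forall t t', f (g t * x * g t') = 0) -> forall u v, f (u * x * v) = 0.
Proof.
move=> ind fg; apply: (ind) => [v|t|c y z hy hz v].
- by rewrite !mul0r dual0.
- apply: ind => [|t'|c y z hy hz]; [by rewrite mulr0 dual0|exact: fg|].
  by rewrite dual_mul_linear hy hz mulr0 addr0.
- by rewrite !mulrDl dualD hz addr0 -!mulrA dualZ mulrA hy mulr0.
Qed.

Lemma sorted_frel_infix (T : eqType) (f : T -> T) (u v : seq T) b c :
  sorted (frel f) (u ++ [:: b, c & v]) -> c = f b.
Proof. by case/cat_sorted2 => _ /= /andP[/eqP]. Qed.

Section TwistedBrauerGraphAlgebra.
Variables (k : fieldType) (Q : gentle_quiver k) (m : {set arrow Q} -> nat).
Hypothesis m_gt0 : forall v, v \in porbits (sigma Q) -> (0 < m v)%N.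
Local Notation I := (@gentle_ideal k Q).
Local Notation J := (@arrow_ideal k Q).
Local Notation sg := (sigma Q).
Local Notation e := (cycle_length m).
Local Notation s := (@arrow_sign k Q).
Local Notation B := (quot I).
Local Notation Lam := (gentle_algebra Q).
Local Notation A := (twisted_brauer_graph_algebra m).

Definition quot_rep : gentle_rep Q B.
Proof.
refine (@GentleRep k Q B (quot_pi I) _ _) => // x Ix.
by rewrite -(rmorph0 (quot_pi I)); apply/quot_piE; rewrite subr0; apply: ideal_genS.
Defined.

Definition completion_rep : gentle_rep Q Lam.
Proof.
refine (@GentleRep k Q Lam (completion_map J \o quot_pi I) _ _) => // x Ix.
by rewrite [LHS]/= (rep_ideal quot_rep Ix) rmorph0.
Defined.

Definition tbga_rep : gentle_rep Q A.
Proof.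
refine (@GentleRep k Q A (quot_pi _ \o completion_rep) _ _) => // x Ix.
exact: etrans (congr1 (quot_pi _) (rep_ideal completion_rep Ix)) (rmorph0 _).
Defined.

Definition cycle_sum (C : kalgebra k) (rho : gentle_rep Q C) : C :=
  \sum_(a : arrow Q) sp rho a (e a).

Lemma sp_completion a l : sp completion_rep a l = completion_map J (sp quot_rep a l).
Proof. by rewrite !spE. Qed.

Lemma sp_tbga a l : sp tbga_rep a l = quot_pi _ (sp completion_rep a l).
Proof. by rewrite !spE. Qed.

Lemma central_eltE : central_elt m = cycle_sum completion_rep.
Proof.
apply: eq_bigr => a _; rewrite /cyclic_path.
have : (0 < #|porbit sg a|)%N by apply/card_gt0P; exists a; apply: porbit_id.
have := iter_porbit sg a; rewrite cycle_lengthE.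
case: #|_| => // l al _; rewrite -sp_expr ?m_gt0 ?imset_f //.
by rewrite -sp_prod.
Qed.

Lemma cycle_sum_level : cycle_sum completion_rep = completion_map J (cycle_sum quot_rep).
Proof. by rewrite /cycle_sum rmorph_sum; apply: eq_bigr => a _; apply: sp_completion. Qed.

(** * The central element acting on paths *)

Section CycleSum.
Variables (C : kalgebra k) (rho : gentle_rep Q C).
Local Notation sp := (sp rho).
Local Notation z := (cycle_sum rho).

(** Only the cycle starting at [iter l sg a] continues the path, and its length is [e a] since both
    arrows lie in one orbit. *)
Lemma cycle_sumM a l : (0 < l)%N -> z * sp a l = sp a (l + e a).
Proof.
move=> l0; rewrite /cycle_sum mulr_suml (bigD1 (iter l sg a)) //=.
rewrite spM ?(cycle_length_gt0 m_gt0) // eqxx cycle_length_iter big1 ?addr0 // => c /negPf ne.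
by rewrite spM ?(cycle_length_gt0 m_gt0) // ne.
Qed.

Lemma cycle_sumMr a l : (0 < l)%N -> sp a l * z = sp a (l + e a).
Proof.
move=> l0; rewrite /cycle_sum mulr_sumr (bigD1 a) //=.
rewrite spM ?(cycle_length_gt0 m_gt0) // iter_cycle_length eqxx.
rewrite addnC big1 ?addr0 // => c /negPf ne.
by rewrite spM ?(cycle_length_gt0 m_gt0) // iter_cycle_length eq_sym ne.
Qed.

(** A trivial path leaves both cycles at its vertex; setting z to 0 makes them opposite in the
    quotient. *)
Lemma cycle_sumM0 a : z * sp a 0 = \sum_(c | src c == src a) sp c (e c).
Proof.
rewrite /cycle_sum mulr_suml [RHS]big_mkcond; apply: eq_bigr => c _.
by rewrite spM0.
Qed.

Lemma cycle_sumM0r a : sp a 0 * z = \sum_(c | src c == src a) sp c (e c).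
Proof.
rewrite /cycle_sum mulr_sumr [RHS]big_mkcond; apply: eq_bigr => c _.
by rewrite sp0M iter_cycle_length eq_sym.
Qed.

Hypothesis rho_surj : forall x, exists f, x = rho f.

Lemma cycle_sum_central x : z * x = x * z.
Proof.
have [f ->] := rho_surj x; apply: (@rep_ind _ _ _ rho (fun x => z * x = x * z)).
- by rewrite mulr0 mul0r.
- by move=> a [|l]; rewrite ?cycle_sumM0 ?cycle_sumM0r // cycle_sumM // cycle_sumMr.
- by move=> c u v hu hv; rewrite mulrDr mulrDl hv mulrA -alg_central -!mulrA hu.
Qed.

(** For positive l, z [sp a l] is longer than a maximal cycle; for l = 0 the two signs at the vertex
    cancel. *)
Lemma dual_cycle_sum (f : dual C) :
  (forall a l, f (sp a l) = if l == e a then s a else 0) -> forall x, f (z * x) = 0.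
Proof.
move=> f_sp x; have [r ->] := rho_surj x.
apply: (@rep_ind _ _ _ rho (fun x => f (z * x) = 0)).
- by rewrite mulr0 dual0.
- move=> a [|l]; last by rewrite cycle_sumM // f_sp; case: eqP => //; lia.
  rewrite cycle_sumM0 dual_sum -[RHS](arrow_sign_sum (src a)).
  by apply: eq_bigr => c _; rewrite f_sp eqxx.
- by move=> c u v hu hv; rewrite dual_mul_linear hu hv mulr0 addr0.
Qed.
End CycleSum.

Lemma quot_rep_surj (x : B) : exists f, x = quot_rep f.
Proof. exact: quot_pi_surj. Qed.

(** The spans by length are multiplicative ideals, and a path of length at least n factors into an
    arrow and a shorter path. This turns the arrow filtration into a statement on lengths. *)
Lemma ideal_pow_sp_span n x : ideal_pow J n x <-> sp_span quot_rep n x.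
Proof.
split.
  have span1 y : J y -> sp_span quot_rep 1 y.
    move=> h; apply: (h _ (sp_span_ideal quot_rep_surj 1)) => _ [a ->].
    rewrite -sigma_path1 -[quot_pi I]/(quot_rep : _ -> _) -spE.
    exact: sp_span_sp.
  elim: n x => [|n IH] x; first by move=> _; apply: (sp_spanT quot_rep_surj).
  move=> h; apply: (h _ (sp_span_ideal quot_rep_surj n.+1)) => _ [a [b [ha hb ->]]].
  by rewrite -add1n; apply: sp_spanM; [apply: span1|apply: IH].
have [J0 JD Jl _] := ideal_pow_ideal J n.
move=> h; apply: (h (ideal_pow J n)) => // [c u v hu hv|a l]; first exact: JD (Jl _ _ hu) hv.
elim: n l {x h J0 JD Jl} => // n IH [//|l] nl.
have -> : sp quot_rep a l.+1 = sp quot_rep (iter l sg a) 1 * sp quot_rep a l.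
  by rewrite sp_cat addn1.
apply: ideal_genS; exists (sp quot_rep (iter l sg a) 1), (sp quot_rep a l).
split=> //; last exact: IH.
by apply: ideal_genS; exists (iter l sg a); rewrite spE sigma_path1.
Qed.

Local Notation N := (\max_(a : arrow Q) e a).+1.

(** As [N] exceeds every cycle length, a path of length l >= N + n is z times its initial part of
    length l - e a > n; positivity of that length is what [cycle_sumM] requires. *)
Lemma ideal_pow_cycle_sum n x : ideal_pow J (N + n) x ->
  exists u, ideal_pow J n u /\ x = cycle_sum quot_rep * u.
Proof.
have [J0 JD Jl _] := ideal_pow_ideal J n.
move/ideal_pow_sp_span => h.
apply: (h (fun x => exists u, ideal_pow J n u /\ x = cycle_sum quot_rep * u)).
- by exists 0; rewrite mulr0.
- move=> c _ _ [u [hu ->]] [v [hv ->]]; exists (alg_map B c * u + v).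
  split; first exact: JD (Jl _ _ hu) hv.
  by rewrite mulrDr !mulrA alg_central.
move=> a l nl; have ea : (e a <= \max_a e a)%N by apply: leq_bigmax.
exists (sp quot_rep a (l - e a)); split.
  by apply/ideal_pow_sp_span; apply: sp_span_sp; lia.
by rewrite cycle_sumM; [congr sp; lia|lia].
Qed.

(** An element of the completion differs from a finite combination of paths with the same component
    at level [N] by a multiple of z, which dies in [A]. *)
Lemma tbga_rep_surj (x : A) : exists f, x = tbga_rep f.
Proof.
have [y ->] := quot_pi_surj x; have [b hb] := quot_pi_surj (level y N).
have [f fb] := quot_pi_surj b; exists f.
apply/quot_piE; apply: ideal_genS; rewrite central_eltE cycle_sum_level.
apply: (completion_divides ideal_pow_cycle_sum).
rewrite -[level _ N]/(level y N - quot_pi _ (quot_pi I f)) hb fb.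
exact: subrr.
Qed.

Lemma cycle_sum_tbga : cycle_sum tbga_rep = 0.
Proof.
transitivity (quot_pi (fun x => exists y, x = central_elt m * y) (cycle_sum completion_rep)).
  by rewrite /cycle_sum rmorph_sum; apply: eq_bigr => a _; apply: sp_tbga.
rewrite -(rmorph0 (quot_pi _)); apply/quot_piE; rewrite subr0.
by apply: ideal_genS; exists 1; rewrite mulr1 central_eltE.
Qed.

Lemma sp_tbga_long a l : (e a < l)%N -> sp tbga_rep a l = 0.
Proof.
move=> al; have <- : ((l - e a) + e a)%N = l by rewrite subnK // ltnW.
by rewrite -cycle_sumM ?subn_gt0 // cycle_sum_tbga mul0r.
Qed.

Lemma sp_tbga_sum i : \sum_(c : arrow Q | src c == i) sp tbga_rep c (e c) = 0.
Proof.
have [a <-] := out_arrow i.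
by rewrite -cycle_sumM0 cycle_sum_tbga mul0r.
Qed.

(* The signs are opposite because the two maximal cycles at a vertex are opposite in A. *)
Definition cycle_weight (w : seq (arrow Q)) : k :=
  if w is a :: _ then if w == traject sg a (e a) then s a else 0 else 0.

Lemma cycle_weight_sigma a l : cycle_weight (traject sg a l) = if l == e a then s a else 0.
Proof.
case: l => [|l] /=; first by case: eqP => // e0; have := cycle_length_gt0 m_gt0 a; rewrite -e0.
case: (l.+1 =P e a) => [<-|ne]; first by rewrite eqxx.
case: eqP => // h; case: ne.
by rewrite -(size_traject sg a (e a)) -h /= size_traject.
Qed.

Lemma cycle_weight_infix u v b c : c <> sg b -> cycle_weight (u ++ [:: b, c & v]) = 0.
Proof.
move=> ne; rewrite /cycle_weight; case ew: (u ++ _) => [//|a w].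
case: eqP => // h; case: ne; apply: (@sorted_frel_infix _ sg u v).
rewrite ew h; case: (e a) => //= n; exact: fpath_traject.
Qed.

Lemma path_length2 (p : qpath Q) : path_length p = 2%N -> exists b c,
  (val p).2 = [:: b; c] /\ of_path k p = arrow_elt k c * arrow_elt k b.
Proof.
case: p => -[i [|b [|c [|]]]] //= w _; exists b, c; split=> //.
have /and3P[/eqP bi /eqP cb _] : [&& src b == i, src c == tgt b & true] := w.
by symmetry; apply: of_path_comp; rewrite //= bi.
Qed.

(** The weights give a form on kQ. It kills I, since a path containing a step off sigma has weight
    0; it kills J^N, whose paths exceed every maximal cycle; and it kills the multiples of z by
    [dual_cycle_sum]. *)
Lemma cycle_form_ex : exists phi : dual A,
  forall a l, phi (sp tbga_rep a l) = if l == e a then s a else 0.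
Proof.
have [f fE] := path_dual (fun p : qpath Q => cycle_weight (val p).2).
have fI u x v : I x -> f (u * x * v) = 0.
  have [_ _ [S [S2 SI]]] := gentleP Q.
  move=> /SI Ix; apply: (@dual_ideal_gen k (path_algebra k Q) _ f _ u x v Ix).
  move=> {u x v Ix} u _ v [p Sp ->].
  have [b [c [pE pM]]] := path_length2 (S2 p Sp).
  have cb : c <> sg b.
    rewrite permE => /sigma_funP; apply; rewrite -pM; apply/SI.
    by apply: ideal_genS; exists p.
  apply: (@dual_span2 _ _ _ _ f _ (@path_algebra_ind k Q)) => q r.
  have [->|[t [-> tE]]] := of_pathM_cases k q p; first by rewrite mul0r dual0.
  have [->|[t' [-> t'E]]] := of_pathM_cases k t r; first by rewrite dual0.
  by rewrite fE t'E tE pE cycle_weight_infix.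
have [g gE] := dual_quot fI.
have g_sp a l : g (sp quot_rep a l) = if l == e a then s a else 0.
  by rewrite spE gE fE cycle_weight_sigma.
have gJ x : ideal_pow J N x -> g x = 0.
  move/ideal_pow_sp_span => h; apply: (h (fun x => g x = 0)) => [|c u v hu hv|a l al].
  - exact: dual0.
  - by rewrite dualD dualZ hu hv mulr0 addr0.
  - have ea : (e a <= \max_a e a)%N by apply: leq_bigmax.
    by rewrite g_sp; case: eqP => // la; move: al; rewrite la; lia.
have gz := dual_cycle_sum quot_rep_surj g_sp.
have [h hE] := dual_completion gJ.
have [|phi phiE] := @dual_quot k Lam (fun x => exists y, x = central_elt m * y) h.
  move=> u _ v [y ->].
  (* The form on the completion sees only level [N], so representatives in kQ/I are taken there,
     where z is central and can be moved to the front. *)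
  have [[[u' uE] [y' yE]] [v' vE]] :=
    (quot_pi_surj (level u N), quot_pi_surj (level y N), quot_pi_surj (level v N)).
  rewrite (hE _ (u' * (cycle_sum quot_rep * y') * v')).
    by rewrite mulrA -(cycle_sum_central quot_rep_surj) -!mulrA gz.
  rewrite central_eltE cycle_sum_level.
  have zE : level (completion_map J (cycle_sum quot_rep)) N = quot_pi _ (cycle_sum quot_rep) by [].
  have uzyE := levelM uE (levelM zE yE).
  exact: (levelM uzyE vE).
exists phi => a l; rewrite sp_tbga phiE sp_completion -g_sp.
exact: hE.
Qed.
End TwistedBrauerGraphAlgebra.

Theorem corollaryB (k : fieldType) (Q : gentle_quiver k)
    (m : {set arrow Q} -> nat)
    (m_gt0 : forall v, v \in porbits (sigma Q) -> (0 < m v)%N) :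
  let A := twisted_brauer_graph_algebra m in
  let A_fd : finite_dimensional A := tbga_finite_dimensional m_gt0 in
  inhabited (derived_nakayama A_fd) /\
  forall nu : derived_nakayama A_fd,
  exists eps : involution A,
    functor_iso nu (twist eps) /\
    exists (nu_perf : preserves (@perfect A) nu)
           (eps_perf : preserves (@perfect A) (twist eps)),
      let S : functor (perf A) (perf A) := restrict nu_perf in
      functor_iso S (restrict eps_perf) /\
      functor_iso (comp_functor S S) (id_functor (perf A)).
Proof.
move=> A A_fd; have [phi phi_sp] := cycle_form_ex m_gt0.
have casimir := gentle_casimir m_gt0 (tbga_rep_surj m_gt0) (sp_tbga_long m_gt0)
  (sp_tbga_sum m_gt0) phi_sp.
have ex := gentle_nakayama_ex (tbga_rep_surj m_gt0) phi_sp.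
have [inh iso] := nakayama_serre A_fd (@frobenius_map_ract _ _ _ _ _ _ casimir ex)
  (@frobenius_map_inj _ _ _ _ _ _ casimir ex) (@frobenius_map_surj _ _ _ _ _ _ casimir ex).
by split=> // nu; exists (nakayama_involution casimir ex); apply: iso.
Qed.
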